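(* Let $(\mathcal{X},d)$ be a Polish space and $\mu\in\mathcal{P}(\mathcal{X})$. Suppose that for some constants $\lambda_o,D>0$, $H(\nu|\mu)\le D\,I(\nu|\mu)$ holds for every probability measure $\nu$ of the form $\nu(dx)=e^{f(x)}\mu(dx)$ with $f\in\mathcal{F}_{\lambda_o}(\mathcal{X})$. Then $\mu$ satisfies $\mathbf{T}_2(\max(4D,1/\lambda_o))$.
   Context: $\mathcal{F}_{\lambda_o}(\mathcal{X})$ is the set of functions $f:\mathcal{X}\to\mathbb{R}$ for which there exist $g:\mathcal{X}\to\mathbb{R}$ and $\lambda\in(0,\lambda_o)$ with $f(x)=\inf_{y\in\mathcal{X}}\{-g(y)+\lambda d^2(x,y)\}$ for all $x$. $H(\nu|\mu)=\int\log(d\nu/d\mu)\,d\nu$ for $\nu\ll\mu$ ($+\infty$ otherwise). The Fisher information is $I(\nu|\mu)=\int|\nabla^+\log(d\nu/d\mu)|^2\,d\nu$, where the local slope is $|\nabla^+g|(x)=\limsup_{y\to x}[g(y)-g(x)]_+/d(y,x)$ ($0$ at isolated points). $\mu$ satisfies $\mathbf{T}_2(C)$ if $W_2^2(\nu,\mu)\le C\,H(\nu|\mu)$ for all $\nu\in\mathcal{P}(\mathcal{X})$, with $W_2^2(\nu,\mu)=\inf_\pi\iint d^2\,d\pi$ over couplings of $\nu$ and $\mu$. *)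

(* Defs.v *)
From HB Require Import structures.
From mathcomp Require Import all_boot all_order all_algebra.
From mathcomp Require Import all_classical all_reals all_analysis.
Set Implicit Arguments. Unset Strict Implicit. Unset Printing Implicit Defensive.
Import Order.TTheory GRing.Theory Num.Theory.
Local Open Scope classical_set_scope.
Local Open Scope ring_scope.

Section Defs.
Context (R : realType) (dd : measure_display) (X : measurableType dd).
Variable (d : X -> X -> R).

Definition is_metric : Prop :=
  [/\ forall x y, 0 <= d x y,
      forall x y, d x y = 0 <-> x = y,
      forall x y, d x y = d y x &
      forall x y z, d x z <= d x y + d y z].

Definition dopen (A : set X) : Prop :=
  forall x, A x -> exists r : R, 0 < r /\ forall y, d x y < r -> A y.

Definition dcomplete : Prop :=
  forall u : nat -> X,
    (forall e : R, 0 < e -> exists N, forall m n, (N <= m)%N -> (N <= n)%N ->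
        d (u m) (u n) < e) ->
    exists l, forall e : R, 0 < e -> exists N, forall n, (N <= n)%N -> d (u n) l < e.

Definition dseparable : Prop :=
  exists S : set X, countable S /\
    forall x (e : R), 0 < e -> exists s, S s /\ d x s < e.

Definition polish_borel : Prop :=
  [/\ is_metric, dcomplete, dseparable &
      forall A : set X, measurable A <-> <<s dopen >> A].

Definition inF (lam0 : R) (f : X -> R) : Prop :=
  exists (g : X -> R) (lam : R), 0 < lam < lam0 /\
    forall x, (f x)%:E = ereal_inf [set (- g y + lam * d x y ^+ 2)%:E | y in [set: X]].

(* local slope |grad^+ g|(x) = limsup_{y -> x} [g y - g x]_+ / d(y,x), 0 at isolated points *)
Definition slope (g : X -> R) (x : X) : \bar R :=
  ereal_inf [set ereal_sup ([set 0%E] `|`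
      [set ((Num.max (g y - g x) 0) / d y x)%:E | y in [set y | 0 < d y x < r]])
    | r in [set r : R | 0 < r]].

(* relative entropy H(nu|mu) = \int (dnu/dmu) log (dnu/dmu) dmu if nu << mu, +oo otherwise;
   as an infimum over (a.e. equal) densities, +oo if there is no density *)
Definition is_density (mu nu : {measure set X -> \bar R}) (g : X -> R) : Prop :=
  [/\ measurable_fun [set: X] g, forall x, 0 <= g x &
      forall A, measurable A -> (nu A = \int[mu]_(x in A) (g x)%:E)%E].

Definition relent (mu nu : {measure set X -> \bar R}) : \bar R :=
  ereal_inf [set (\int[mu]_x (g x * ln (g x))%:E)%E | g in is_density mu nu].

(* Fisher information of nu = e^f mu w.r.t. mu: \int |grad^+ f|^2 dnu *)
Definition fisher (mu : {measure set X -> \bar R}) (f : X -> R) : \bar R :=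
  \int[mu]_x ((slope f x) ^+ 2 * (expR (f x))%:E)%E.

Definition coupling (nu mu : set X -> \bar R) (pi : set (X * X) -> \bar R) : Prop :=
  forall A B : set X, measurable A -> measurable B ->
    (pi (A `*` [set: X]) = nu A)%E /\ (pi ([set: X] `*` B) = mu B)%E.

Definition W2sq (nu mu : probability X R) : \bar R :=
  ereal_inf [set (\int[pi]_z (d z.1 z.2 ^+ 2)%:E)%E
    | pi in [set pi : probability (X * X)%type R | coupling nu mu pi]].

Definition T2 (mu : probability X R) (C : R) : Prop :=
  forall nu : probability X R, (W2sq nu mu <= C%:E * relent mu nu)%E.

End Defs.

(* Main.v *)
(** For bounded [h] put [f_k x = inf_y (k h y + lam d(x,y)^2)] and
    [L k = ln \int e^(f_k) dmu], where [lam < lam0] and [4 D lam <= 1].  If [y] is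
    optimal at [x], the slope of [f_k] at [x] is at most [2 lam d(x,y)], and
    [lam d(x,y)^2] is at most the intercept of a chord of the concave function
    [k |-> f_k x].  The restricted log-Sobolev inequality for [e^(f_k - L k) mu] then
    makes [L k / k] nonincreasing up to quadratic errors, and letting [k] run from
    [0] to [1] gives [\int e^(f_1) dmu <= e^(\int h dmu)].

    By the Donsker-Varadhan inequality, [\int phi dnu - \int psi dmu <= H(nu|mu)] as
    soon as [phi x <= psi y + lam d(x,y)^2].  For truncations of multiples of
    [d(., x0)^2] this transfers finite second moments between [mu] and [nu], first
    from [mu] conditioned on a ball to [mu].  Both measures may thus be quantised on
    finitely many cells, where Kantorovich duality follows from an entropic
    regularisation; an optimal plan between the cells is spread inside them as
    products of conditional measures, which gives a coupling of cost at most
    [H(nu|mu) / lam] up to small errors. *)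

Require Import Defs.
From HB Require Import structures.
From mathcomp Require Import all_boot all_order all_algebra.
From mathcomp Require Import all_classical all_reals all_analysis.
From mathcomp Require Import measurable_realfun ring lra.
Import Order.TTheory GRing.Theory Num.Theory.
Local Open Scope classical_set_scope.
Local Open Scope ring_scope.
Import numFieldNormedType.Exports.
Set Implicit Arguments.
Unset Strict Implicit.
Unset Printing Implicit Defensive.

(** * Real analysis *)

Section real_inequalities.
Context (R : realType).
Implicit Types a s x y z w eta : R.

Lemma expR_le_quadratic x : x <= 1/2 -> expR x <= 1 + x + 2 * x ^+ 2.
Proof.
move=> x12; have e0 := expR_gt0 x.
have : expR x * (1 - x) <= 1.
  have h := expR_ge1Dx (- x); rewrite -[leRHS](mulfV (lt0r_neq0 e0)).
  by rewrite ler_pM2l// -expRN.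
nra.
Qed.

Lemma mul2_le_expR x : 2 * x <= expR x.
Proof.
have [x0|x0] := ltP x 0; first by have := expR_ge0 x; lra.
have -> : expR x = expR (x / 2) * expR (x / 2) by rewrite -expRD -splitr.
have : (1 + x / 2) * (1 + x / 2) <= expR (x / 2) * expR (x / 2).
  by apply: ler_pM (expR_ge1Dx _) (expR_ge1Dx _) => //; lra.
by have := sqr_ge0 (1 - x / 2); lra.
Qed.

Lemma oppr_mul_expR_le1 x : - x * expR x <= 1.
Proof.
rewrite -(@ler_pM2r _ (expR (- x))) ?expR_gt0// -mulrA -expRD subrr expR0.
by have := expR_ge1Dx (- x); lra.
Qed.

Lemma sqrD3_le eta x y z w : 0 < eta -> 0 <= x ->
  x <= y + z + w -> x ^+ 2 <= (1 + eta) * (z ^+ 2 + 2 / eta * (y ^+ 2 + w ^+ 2)).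
Proof.
move=> eta0 x0 x_le; have x2_le : x ^+ 2 <= (y + z + w) ^+ 2.
  by apply: lerXn2r; rewrite ?nnegrE//; exact: le_trans x_le.
rewrite (le_trans x2_le)// -(ler_pM2l eta0).
have -> : eta * ((1 + eta) * (z ^+ 2 + 2 / eta * (y ^+ 2 + w ^+ 2))) =
  (1 + eta) * (eta * z ^+ 2 + 2 * (y ^+ 2 + w ^+ 2)) by field; rewrite gt_eqF.
have := sqr_ge0 (eta * z - (y + w)); have := sqr_ge0 (y - w).
have := mulr_ge0 (ltW eta0) (sqr_ge0 (y - w)); nra.
Qed.

Lemma eq_slope_of_expR_bound a s :
  (forall t, a * t <= s * (expR t - 1)) -> a = s.
Proof.
move=> ats; pose f t := s * (expR t - 1) - a * t.
have df (t : R) : is_derive t 1 f (s * expR t - a).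
  by rewrite /f; apply: is_derive_eq; rewrite /GRing.scale/=; ring.
have : is_derive (0 : R) 1 f 0.
  apply: (@derive1_at_min _ f (- 1) 1 0) => [|t _|//|t _].
  - lra.
  - exact: ex_derive.
  - by rewrite in_itv/=; lra.
  - by rewrite /f expR0 subrr !mulr0 subrr subr_ge0.
move=> [_]; rewrite (@derive_val _ _ _ _ _ _ _ (df 0)) expR0 mulr1.
by move/eqP; rewrite subr_eq0 => /eqP.
Qed.

End real_inequalities.

Lemma ler_sumr_term (R : numDomainType) (I : finType) (F : I -> R) i :
  (forall j, 0 <= F j) -> F i <= \sum_j F j.
Proof. by move=> F0; rewrite (bigD1 i)//= lerDl sumr_ge0. Qed.

Lemma lee_at_right (R : realType) (f : R -> R) (a : R) (x : \bar R) :
  {for a, continuous f} -> (forall t, a < t -> (x <= (f t)%:E)%E) ->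
  (x <= (f a)%:E)%E.
Proof.
move=> fa xf.
have fa_right : (f t)%:E @[t --> a^'+] --> (f a)%:E.
  by apply: cvg_EFin; [exact: nearW|exact: cvg_at_right_filter].
apply: (cvge_to_ge fa_right).
by near=> t; apply: xf; near: t; exact: nbhs_right_gt.
Unshelve. all: end_near. Qed.

Section quadratic_defect.
Context (R : realType).
Variables (G : R -> R) (a b C eps : R).
Hypotheses (eps_gt0 : 0 < eps) (ab : a <= b).
Hypothesis defect : forall s t, a <= s -> s < t -> t <= b -> t - s <= eps ->
  G t <= G s + C * (t - s) ^+ 2.

Let subdivision_le w n : 0 < w -> w <= eps -> a + n%:R * w <= b ->
  G (a + n%:R * w) <= G a + n%:R * (C * w ^+ 2).
Proof.
move=> w0 w_eps; elim: n => [_|n IH]; first by rewrite !mul0r !addr0.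
have -> : a + n.+1%:R * w = a + n%:R * w + w by rewrite -natr1; ring.
move=> nb; have {}IH := IH (le_trans (ltW (ltr_pwDr w0 (lexx _))) nb).
have := defect (s := a + n%:R * w) _ (ltr_pwDr w0 (lexx _)) nb.
rewrite [X in X <= eps]addrC addKr -natr1 lerDl mulr_ge0 ?(ltW w0)//.
by move=> /(_ isT w_eps); lra.
Qed.

(* Over a subdivision of mesh [w] the defects add up to [O(w)]. *)
Lemma nonincreasing_of_quadratic_defect : G b <= G a.
Proof.
have [->//|a_neq_b] := eqVneq a b.
have l0 : 0 < b - a by rewrite subr_gt0 lt_neqAle a_neq_b.
apply/ler_addgt0Pr => e e0.
pose K := (b - a) / eps + `|C| * (b - a) ^+ 2 / e.
have mesh_K : (b - a) / eps <= K by rewrite lerDl divr_ge0 ?mulr_ge0 ?sqr_ge0// ltW.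
have defect_K : `|C| * (b - a) ^+ 2 / e <= K by rewrite lerDr divr_ge0// ltW.
pose n := (Num.truncn K).+1; have Kn : K <= n%:R by rewrite ltW// truncnS_gt.
have n0 : 0 < n%:R :> R by rewrite ltr0n.
pose w := (b - a) / n%:R; have nw : n%:R * w = b - a by rewrite mulrC divfK ?gt_eqF.
have w0 : 0 < w by rewrite divr_gt0.
have w_eps : w <= eps by rewrite ler_pdivrMr// mulrC -ler_pdivrMr// (le_trans mesh_K).
have := subdivision_le (n := n) w0 w_eps; rewrite nw subrKC => /(_ (lexx b)).
move=> /le_trans; apply; rewrite lerD2l.
have -> : n%:R * (C * w ^+ 2) = C * (b - a) ^+ 2 / n%:R.
  by rewrite /w; field; rewrite gt_eqF.
rewrite ler_pdivrMr//; apply: (@le_trans _ _ (`|C| * (b - a) ^+ 2)).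
  by rewrite ler_wpM2r ?sqr_ge0// ler_norm.
by rewrite (mulrC e) -ler_pdivrMr// (le_trans defect_K).
Qed.

End quadratic_defect.

(** * Finite optimal transport *)

Section entropic_dual.
Context (R : realType).

Definition entropic_payoff (e x s : R) : R := s - e * expR ((s - x) / e).

Lemma entropic_payoff_le (e x s : R) : 0 < e -> entropic_payoff e x s <= x.
Proof.
move=> e0; rewrite /entropic_payoff; set y := (s - x) / e.
have -> : s = x + e * y by rewrite /y; field; rewrite gt_eqF.
by have := ler_wpM2l (ltW e0) (expR_ge1Dx y); lra.
Qed.

Lemma entropic_payoff_coercive (e x s L : R) : 0 < e -> 0 <= x -> 0 <= L ->
  - L <= entropic_payoff e x s -> `|s| <= 2 * x + L.
Proof.
move=> e0 x0 L0; rewrite /entropic_payoff; set y := (s - x) / e.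
have -> : s = x + e * y by rewrite /y; field; rewrite gt_eqF.
have := ler_wpM2l (ltW e0) (mul2_le_expR y).
have := mulr_ge0 (ltW e0) (expR_ge0 y); rewrite ler_norml => *.
by apply/andP; split; lra.
Qed.

Lemma continuous_entropic_payoff (e x : R) : continuous (entropic_payoff e x).
Proof.
move=> s; apply: cvgB => //; apply: cvgM; first exact: cvg_cst.
apply: continuous_cvg; first exact: continuous_expR.
by apply: cvgM; [apply: cvgB => //|]; exact: cvg_cst.
Qed.

Variables (I J : finType) (a : I -> R) (b : J -> R) (c : I -> J -> R) (e : R).
Implicit Types (u : I -> R) (v : J -> R).

Definition entropic_dual u v : R :=
  \sum_i \sum_j a i * b j * entropic_payoff e (c i j) (u i + v j).

Definition entropic_plan u v i j : R :=
  a i * b j * expR ((u i + v j - c i j) / e).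

Hypotheses (e_gt0 : 0 < e) (a_ge0 : forall i, 0 <= a i)
  (b_ge0 : forall j, 0 <= b j).

Lemma entropic_plan_ge0 u v i j : 0 <= entropic_plan u v i j.
Proof. by rewrite mulr_ge0 ?expR_ge0// mulr_ge0. Qed.

Lemma eq_entropic_dual u v u' v' :
  (forall i j, 0 < a i -> 0 < b j -> u' i + v' j = u i + v j) ->
  entropic_dual u' v' = entropic_dual u v.
Proof.
move=> uv; apply: eq_bigr => i _; apply: eq_bigr => j _.
have [ai|ai] := ltP 0 (a i); last first.
  by rewrite (_ : a i = 0) ?mul0r//; have := a_ge0 i; lra.
have [bj|bj] := ltP 0 (b j); first by rewrite uv.
by rewrite (_ : b j = 0) ?mulr0 ?mul0r//; have := b_ge0 j; lra.
Qed.

Lemma entropic_plan_row u v : \sum_j b j = 1 ->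
  (forall u', entropic_dual u' v <= entropic_dual u v) ->
  forall i, \sum_j entropic_plan u v i j = a i.
Proof.
move=> b1 umax i; apply/esym/eq_slope_of_expR_bound => t.
have := umax (fun k => if k == i then u i + e * t else u k).
rewrite /entropic_dual (bigD1 i)//= eqxx [leRHS](bigD1 i)//=.
rewrite [X in _ + X <= _](eq_bigr
  (fun k => \sum_j a k * b j * entropic_payoff e (c k j) (u k + v j))); last first.
  by move=> k /negbTE ->.
rewrite lerD2r -subr_le0 -sumrB.
rewrite (eq_bigr (fun j =>
  e * (a i * t * b j - (expR t - 1) * entropic_plan u v i j))); last first.
  move=> j _; rewrite /entropic_plan /entropic_payoff.
  have -> : (u i + e * t + v j - c i j) / e = (u i + v j - c i j) / e + t.
    by field; rewrite gt_eqF.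
  by rewrite expRD; ring.
rewrite -mulr_sumr pmulr_rle0// sumrB -!mulr_sumr b1 mulr1 subr_le0.
by rewrite (mulrC (expR t - 1)).
Qed.

Hypothesis c_ge0 : forall i j, 0 <= c i j.

Lemma entropic_dual_coercive : exists2 B : R, 0 <= B &
  forall u v, entropic_dual (fun=> 0) (fun=> 0) <= entropic_dual u v ->
    forall i j, 0 < a i -> 0 < b j -> `|u i + v j| <= B.
Proof.
pose W := \sum_i \sum_j a i * b j * c i j.
have W_term u v i j : entropic_dual u v <=
    a i * b j * entropic_payoff e (c i j) (u i + v j) + W.
  rewrite /entropic_dual /W (bigD1 i)//= (bigD1 j)//= -addrA lerD2l.
  rewrite [leRHS](bigD1 i)//= [\sum_j a i * b j * c i j](bigD1 j)//= -addrA.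
  rewrite ler_wpDl//.
    by rewrite !mulr_ge0.
  apply: lerD; apply: ler_sum => k _; last apply: ler_sum => l _.
    by rewrite ler_wpM2l ?mulr_ge0//; exact: entropic_payoff_le.
  by rewrite ler_wpM2l ?mulr_ge0//; exact: entropic_payoff_le.
pose L := W - entropic_dual (fun=> 0) (fun=> 0).
have L0 : 0 <= L.
  rewrite subr_ge0; apply: ler_sum => i _; apply: ler_sum => j _.
  by rewrite ler_wpM2l ?mulr_ge0//; exact: entropic_payoff_le.
pose B i j := 2 * c i j + L / (a i * b j).
have B0 i j : 0 <= B i j by rewrite addr_ge0 ?divr_ge0 ?mulr_ge0.
exists (\sum_i \sum_j B i j); first by apply: sumr_ge0 => i _; exact: sumr_ge0.
move=> u v uv i j ai bj; apply: (@le_trans _ _ (B i j)); last first.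
  apply: le_trans (ler_sumr_term j (B0 i)) _.
  by apply: (ler_sumr_term (F := fun i => \sum_j B i j)) => k; exact: sumr_ge0.
apply: (@entropic_payoff_coercive e) => //; first by rewrite divr_ge0 ?mulr_ge0.
rewrite -mulNr ler_pdivrMr ?mulr_gt0// mulrC.
by have := W_term u v i j; rewrite /L; lra.
Qed.

Import ArrowAsProduct.

Lemma continuous_entropic_dual :
  continuous (fun t : (I -> R) * (J -> R) => entropic_dual t.1 t.2).
Proof.
apply: (continuous_big (op := +%R)) => [|i _]; first exact: add_continuous.
apply: (continuous_big (op := +%R)) => [|j _ t]; first exact: add_continuous.
apply: (@continuous_comp _ _ _ (fun z : (I -> R) * (J -> R) => z.1 i + z.2 j)
  (fun s => a i * b j * entropic_payoff e (c i j) s)); last first.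
  by apply: cvgM; [exact: cvg_cst|exact: continuous_entropic_payoff].
apply: (@cvgD _ _ _ (nbhs t) _ (fun z => z.1 i) (fun z => z.2 j)).
  apply: (@continuous_comp _ _ _ fst (@proj I (fun=> R) i)); first exact: cvg_fst.
  exact: proj_continuous.
apply: (@continuous_comp _ _ _ snd (@proj J (fun=> R) j)); first exact: cvg_snd.
exact: proj_continuous.
Qed.

(* Only the sums [u i + v j] over the supports of [a] and [b] matter.  Setting [v j0]
   to [0] by a shift, and the values off the supports to [0], confines the pairs of
   interest to a compact box. *)
Lemma entropic_dual_has_max : (exists i, 0 < a i) -> (exists j, 0 < b j) ->
  exists u v, forall u' v', entropic_dual u' v' <= entropic_dual u v.
Proof.
move=> [i0 ai0] [j0 bj0]; have [B B0 coercive] := entropic_dual_coercive.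
pose box (T : finType) : set (T -> R) :=
  [set w | forall k, `[- (2 * B), 2 * B]%classic (w k)].
have box_compact : compact (box I `*` box J).
  by apply: compact_setX; apply: (@tychonoff _ (fun=> R)
    (fun=> `[- (2 * B), 2 * B]%classic)) => k; exact: segment_compact.
have box0 : (box I `*` box J) (fun=> 0, fun=> 0).
  by split=> k /=; rewrite in_itv/=; lra.
have [t _ tmax] := @compact_EVT_max _ R _ _ (ex_intro _ _ box0) box_compact
  (continuous_subspaceT continuous_entropic_dual).
exists t.1, t.2 => u v.
have [uv0|uv0] := leP (entropic_dual u v) (entropic_dual (fun=> 0) (fun=> 0)).
  exact: le_trans uv0 (tmax _ (mem_set box0)).
have uvB := coercive _ _ (ltW uv0).
pose t' := (fun i => if 0 < a i then u i + v j0 else 0,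
            fun j => if 0 < b j then v j - v j0 else 0).
rewrite -(@eq_entropic_dual u v t'.1 t'.2); last first.
  by move=> i j ai bj; rewrite /= ai bj; ring.
apply: (tmax t'); rewrite inE; split=> [i|j] /=; rewrite in_itv/= -ler_norml.
  by case: ifPn => [ai|_]; [have := uvB i j0 ai bj0; lra|rewrite normr0; lra].
case: ifPn => [bj|_]; last by rewrite normr0; lra.
have -> : v j - v j0 = (u i0 + v j) - (u i0 + v j0) by ring.
apply: (le_trans (ler_normB _ _)).
by have := uvB i0 j ai0 bj; have := uvB i0 j0 ai0 bj0; lra.
Qed.

End entropic_dual.

Lemma entropic_dualC (R : realType) (I J : finType) (a : I -> R) (b : J -> R)
    (c : I -> J -> R) (e : R) (u : I -> R) (v : J -> R) :
  entropic_dual a b c e u v = entropic_dual b a (fun j i => c i j) e v u.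
Proof.
rewrite /entropic_dual exchange_big; apply: eq_bigr => j _.
by apply: eq_bigr => i _; rewrite (mulrC (a i)) (addrC (u i)).
Qed.

Section transport_plan.
Context (R : realType) (I J : finType).
Implicit Types (a : I -> R) (b : J -> R) (c p : I -> J -> R).

Definition transport_plan a b p : Prop :=
  [/\ forall i j, 0 <= p i j, forall i, \sum_j p i j = a i &
      forall j, \sum_i p i j = b j].

Definition transport_cost c p : R := \sum_i \sum_j p i j * c i j.

Lemma transport_costZ k c p :
  transport_cost (fun i j => k * c i j) p = k * transport_cost c p.
Proof.
rewrite /transport_cost mulr_sumr; apply: eq_bigr => i _; rewrite mulr_sumr.
by apply: eq_bigr => j _; rewrite mulrCA.
Qed.

End transport_plan.

Section finite_transport_duality.
Context (R : realType) (I J : finType).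
Variables (a : I -> R) (b : J -> R) (c : I -> J -> R).
Hypothesis c_ge0 : forall i j, 0 <= c i j.

Lemma feasible_potentials_extension (P : pred I) (Q : pred J)
    (u : I -> R) (v : J -> R) :
  (forall i j, P i -> Q j -> u i + v j <= c i j) ->
  exists u' v', [/\ forall i j, u' i + v' j <= c i j,
    forall i, P i -> u' i = u i & forall j, Q j -> v' j = v j].
Proof.
move=> uv; pose Bu := \sum_i `|u i|; pose Bv := \sum_j `|v j|.
have Bu0 : 0 <= Bu by exact: sumr_ge0.
have Bv0 : 0 <= Bv by exact: sumr_ge0.
exists (fun i => if P i then u i else - Bv), (fun j => if Q j then v j else - Bu).
split=> [i j|i|j]; [|by move=> ->..].
have uB : u i <= Bu.
  exact: le_trans (ler_norm _) (ler_sumr_term (F := fun k => `|u k|) i _).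
have vB : v j <= Bv.
  exact: le_trans (ler_norm _) (ler_sumr_term (F := fun k => `|v k|) j _).
have := uv i j; have := c_ge0 i j.
by case: (P i); case: (Q j) => /= cij uvij; [exact: uvij|lra..].
Qed.

Hypotheses (a_ge0 : forall i, 0 <= a i) (b_ge0 : forall j, 0 <= b j).
Hypotheses (a1 : \sum_i a i = 1) (b1 : \sum_j b j = 1).

Lemma transport_plan_entropic (e : R) (u : I -> R) (v : J -> R) : 0 < e ->
  (forall u' v', entropic_dual a b c e u' v' <= entropic_dual a b c e u v) ->
  transport_plan a b (entropic_plan a b c e u v).
Proof.
move=> e0 uvmax; split=> [i j|i|j]; first exact: entropic_plan_ge0.
  exact: entropic_plan_row.
rewrite -(@entropic_plan_row _ _ _ b a (fun j i => c i j) e e0 v u a1)//.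
  by apply: eq_bigr => i _; rewrite /entropic_plan (mulrC (a i)) (addrC (u i)).
by move=> v'; have := uvmax u v'; rewrite !(entropic_dualC a b).
Qed.

Lemma transport_cost_entropic_le (e : R) (u : I -> R) (v : J -> R) : 0 < e ->
  transport_plan a b (entropic_plan a b c e u v) ->
  transport_cost c (entropic_plan a b c e u v) <=
    \sum_i a i * u i + \sum_j b j * v j + e.
Proof.
move=> e0 [_]; set p := entropic_plan a b c e u v => row_sum col_sum.
have cell_le i j : p i j * c i j <= p i j * u i + p i j * v j + e * (a i * b j).
  rewrite /p /entropic_plan; set x := (u i + v j - c i j) / e.
  have -> : c i j = u i + v j - e * x by rewrite /x; field; rewrite gt_eqF.
  have := ler_wpM2l (mulr_ge0 (ltW e0) (mulr_ge0 (a_ge0 i) (b_ge0 j)))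
    (oppr_mul_expR_le1 x); lra.
have -> : \sum_i a i * u i = \sum_i \sum_j p i j * u i.
  by apply: eq_bigr => i _; rewrite -mulr_suml row_sum.
have -> : \sum_j b j * v j = \sum_i \sum_j p i j * v j.
  by rewrite exchange_big; apply: eq_bigr => j _; rewrite -mulr_suml col_sum.
have -> : e = \sum_i \sum_j e * (a i * b j).
  under eq_bigr do rewrite -mulr_sumr -mulr_sumr b1 mulr1.
  by rewrite -mulr_sumr a1 mulr1.
rewrite -!big_split/=; apply: ler_sum => i _.
by rewrite -!big_split/=; apply: ler_sum => j _; exact: cell_le.
Qed.

Let exists_gt0 (K : finType) (w : K -> R) : \sum_k w k = 1 -> exists k, 0 < w k.
Proof.
move=> w1; apply: contrapT => /forallNP wN.
suff: \sum_k w k <= 0 by rewrite w1 leNgt ltr01.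
by apply: sumr_le0 => k _; rewrite leNgt; exact/negP/wN.
Qed.

(* For the maximiser [u], [v] of the entropic dual, [entropic_plan u v i j <= b j]
   says that [u i + e * ln (a i)] and [v j] are feasible. *)
Lemma entropic_transport_duality (e : R) : 0 < e ->
  exists p u v, [/\ transport_plan a b p,
    forall i j, 0 < a i -> 0 < b j -> u i + v j <= c i j &
    transport_cost c p <= \sum_i a i * u i + \sum_j b j * v j + e * #|I|.+1%:R].
Proof.
move=> e0; have [u [v uvmax]] := entropic_dual_has_max e0 a_ge0 b_ge0 c_ge0
  (exists_gt0 a1) (exists_gt0 b1).
have plan_p := transport_plan_entropic e0 uvmax.
have [p_ge0 _ col_sum] := plan_p.
exists (entropic_plan a b c e u v), (fun i => u i + e * ln (a i)), v.
split=> [//|i j ai bj|].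
  have : expR ((u i + v j - c i j) / e + ln (a i)) <= 1.
    have p_le : entropic_plan a b c e u v i j <= b j.
      by rewrite -col_sum; exact: (ler_sumr_term i (p_ge0^~ j)).
    rewrite expRD lnK ?posrE// -(ler_pM2l bj) mulr1 (le_trans _ p_le)//.
    by rewrite /entropic_plan; lra.
  by rewrite expR_le1 -(ler_pM2l e0) mulr0 mulrDr mulrCA mulfV ?gt_eqF//; lra.
rewrite (le_trans (transport_cost_entropic_le e0 plan_p))//.
have entropy_le i : - (a i * ln (a i)) <= 1.
  have [ai|ai] := ltP 0 (a i); last by rewrite ln0// mulr0 oppr0.
  by have := oppr_mul_expR_le1 (ln (a i)); rewrite lnK ?posrE//; lra.
under [X in _ <= X + _ + _]eq_bigr do rewrite mulrDr.
rewrite big_split/= -natr1 mulrDr mulr1.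
suff : 0 <= \sum_i a i * (e * ln (a i)) + e * #|I|%:R by lra.
rewrite mulr_natr -sumr_const -big_split/= sumr_ge0// => i _.
by have := ler_wpM2l (ltW e0) (entropy_le i); lra.
Qed.

Lemma finite_transport_duality (e : R) : 0 < e ->
  exists p u v, [/\ transport_plan a b p, forall i j, u i + v j <= c i j &
    transport_cost c p <= \sum_i a i * u i + \sum_j b j * v j + e].
Proof.
move=> e0; have e'0 : 0 < e / #|I|.+1%:R by rewrite divr_gt0.
have [p [u [v [plan_p uv cost_le]]]] := entropic_transport_duality e'0.
have [u' [v' [uv' uE vE]]] := feasible_potentials_extension uv.
exists p, u', v'; split=> //; move: cost_le; rewrite divfK ?gt_eqF//.
have weighted_eq (K : finType) (w f f' : K -> R) : (forall k, 0 <= w k) ->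
    (forall k, 0 < w k -> f' k = f k) -> \sum_k w k * f' k = \sum_k w k * f k.
  move=> w0 ff'; apply: eq_bigr => k _; have [/ff' -> //|wk] := ltP 0 (w k).
  by rewrite (_ : w k = 0) ?mul0r//; have := w0 k; lra.
by rewrite (weighted_eq _ _ _ _ a_ge0 uE) (weighted_eq _ _ _ _ b_ge0 vE).
Qed.

End finite_transport_duality.

(** * Densities and relative entropy *)

(* No measurability is needed: the integral of a nonnegative function is the
   supremum of the integrals of the simple functions below it. *)
Lemma le_integralT (dd : measure_display) (T : measurableType dd) (R : realType)
    (mu : {measure set T -> \bar R}) (f g : T -> \bar R) :
  (forall x, (f x <= g x)%E) -> (\int[mu]_x f x <= \int[mu]_x g x)%E.
Proof.
have ge0_le (p q : T -> \bar R) : (forall x, (0 <= p x)%E) ->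
    (forall x, (p x <= q x)%E) -> (\int[mu]_x p x <= \int[mu]_x q x)%E.
  move=> p0 pq; have q0 x : (0 <= q x)%E by exact: le_trans (pq x).
  rewrite !ge0_integralTE//; apply: ge_ereal_sup => _ [h hp <-].
  by apply: ereal_sup_ubound; exists h => // x; exact: le_trans (pq x).
move=> fg; rewrite integralE [leRHS]integralE.
apply: leeB; apply: ge0_le => x; do ?[exact: funepos_ge0|exact: funeneg_ge0].
  by apply: (@funepos_le _ _ setT); rewrite ?inE// => y _; exact: fg.
by apply: (@funeneg_le _ _ setT); rewrite ?inE// => y _; exact: fg.
Qed.

Section bounded_measurable.
Context (R : realType) (dd : measure_display) (T : measurableType dd).
Implicit Types (f g : T -> R) (k : R).

Definition bounded_measurable f : Prop :=
  measurable_fun [set: T] f /\ exists M : R, forall x, `|f x| <= M.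

Lemma bounded_measurable_cst k : bounded_measurable (fun=> k).
Proof. by split; [exact: measurable_cst|exists `|k|]. Qed.

Lemma bounded_measurableD f g : bounded_measurable f -> bounded_measurable g ->
  bounded_measurable (fun x => f x + g x).
Proof.
move=> [mf [M fM]] [mg [N gN]]; split; first exact: measurable_funD.
by exists (M + N) => x; apply: (le_trans (ler_normD _ _)); exact: lerD.
Qed.

Lemma bounded_measurableM f g : bounded_measurable f -> bounded_measurable g ->
  bounded_measurable (fun x => f x * g x).
Proof.
move=> [mf [M fM]] [mg [N gN]]; split; first exact: measurable_funM.
by exists (M * N) => x; rewrite normrM; exact: ler_pM.
Qed.

Lemma bounded_measurableZ k f : bounded_measurable f ->
  bounded_measurable (fun x => k * f x).
Proof. exact/bounded_measurableM/bounded_measurable_cst. Qed.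

Lemma bounded_measurableN f : bounded_measurable f ->
  bounded_measurable (fun x => - f x).
Proof.
move=> [mf [M fM]]; split; first exact: measurableT_comp.
by exists M => x; rewrite normrN.
Qed.

Lemma bounded_measurableB f g : bounded_measurable f -> bounded_measurable g ->
  bounded_measurable (fun x => f x - g x).
Proof.
by move=> bf bg; apply: bounded_measurableD => //; exact: bounded_measurableN.
Qed.

Lemma bounded_measurable_expR f : bounded_measurable f ->
  bounded_measurable (fun x => expR (f x)).
Proof.
move=> [mf [M fM]]; split; first exact: measurableT_comp.
exists (expR M) => x; rewrite ger0_norm ?expR_ge0// ler_expR.
exact: le_trans (ler_norm _) (fM x).
Qed.

Lemma bounded_measurable_min f k : measurable_fun [set: T] f ->
  (forall x, 0 <= f x) -> bounded_measurable (fun x => Num.min (f x) k).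
Proof.
move=> mf f0; split; first exact: measurable_minr.
exists `|k| => x; rewrite minEle; case: ifPn => // fk.
by rewrite ger0_norm// (le_trans fk)// ler_norm.
Qed.

Lemma bounded_measurable_indic A : measurable A ->
  bounded_measurable (\1_A : T -> R).
Proof.
move=> mA; split; first exact: measurable_indic.
by exists 1 => x; rewrite indicE; case: (x \in A); rewrite ?normr1 ?normr0.
Qed.

Variable P : probability T R.

Lemma bounded_measurable_integrable f : bounded_measurable f ->
  P.-integrable setT (EFin \o f).
Proof.
move=> [mf [M fM]]; apply: measurable_bounded_integrable => //.
  by apply: (@le_lt_trans _ _ 1%E); [exact: probability_le1|exact: ltry].
exists M; split; first exact: num_real.
by move=> y My x _; exact: le_trans (fM x) (ltW My).
Qed.

Lemma integral_bounded_measurable f : bounded_measurable f ->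
  (\int[P]_x (f x)%:E)%E = (\int[P]_x f x)%:E.
Proof.
move=> bf; rewrite /Rintegral fineK//.
exact: integrable_fin_num (bounded_measurable_integrable bf).
Qed.

Lemma Rintegral_probability_cst k : \int[P]_x k = k.
Proof.
rewrite Rintegral_cst// -[LHS]/(k * fine (P setT)) probability_setT.
by rewrite mulr1.
Qed.

End bounded_measurable.

Section density.
Context (dd : measure_display) (T : measurableType dd) (R : realType).

Section exists_probability.
Variables (mu : {measure set T -> \bar R}) (g : T -> R).
Hypotheses (mg : measurable_fun [set: T] g) (g0 : forall x, 0 <= g x).

Let nu (A : set T) : \bar R := (\int[mu]_(x in A) (g x)%:E)%E.

Let nu0 : nu set0 = 0%E. Proof. exact: integral_set0. Qed.

Let nu_ge0 A : (0 <= nu A)%E.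
Proof. by apply: integral_ge0 => x _; rewrite lee_fin. Qed.

Let nu_semi_sigma_additive : semi_sigma_additive nu.
Proof.
apply: semi_sigma_additive_nng_induced; first exact/measurable_EFinP.
by move=> x; rewrite lee_fin.
Qed.

HB.instance Definition _ :=
  isMeasure.Build _ _ _ nu nu0 nu_ge0 nu_semi_sigma_additive.

Hypothesis g1 : (\int[mu]_x (g x)%:E = 1)%E.

HB.instance Definition _ := @Measure_isProbability.Build _ _ R nu g1.

Lemma exists_probability_density :
  exists nu : probability T R, is_density mu nu g.
Proof. by exists nu. Qed.

End exists_probability.

Variables (mu : {sigma_finite_measure set T -> \bar R}) (nu : probability T R).
Variable g : T -> R.
Hypothesis gd : is_density mu nu g.

Let mg : measurable_fun [set: T] g. Proof. by case: gd. Qed.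
Let g0 x : 0 <= g x. Proof. by case: gd. Qed.

Lemma integral_density1 : (\int[mu]_x (g x)%:E = 1)%E.
Proof. by case: gd => _ _ <-//; exact: probability_setT. Qed.

Lemma density_integrable : mu.-integrable setT (EFin \o g).
Proof.
apply/integrableP; split; first exact/measurable_EFinP.
under eq_integral do rewrite /= ger0_norm//.
by rewrite integral_density1 ltry.
Qed.

Lemma Rintegral_density1 : \int[mu]_x g x = 1.
Proof. by rewrite /Rintegral integral_density1. Qed.

Lemma density_dominates : nu `<< mu.
Proof.
apply/null_content_dominatesP => A mA muA0; case: gd => _ _ ->//.
by apply: null_set_integral => //; exact/measurable_funTS/measurable_EFinP.
Qed.

Lemma integral_density f : nu.-integrable setT f ->
  (\int[nu]_x f x = \int[mu]_x (f x * (g x)%:E))%E.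
Proof.
move=> fi; have numu := density_dominates; have mf := measurable_int _ fi.
have mE : measurable_fun [set: T] (EFin \o g) by exact/measurable_EFinP.
rewrite -(Radon_Nikodym_change_of_variables numu)//.
apply: ae_eq_integral => //; first exact: emeasurable_funM.
- exact: emeasurable_funM.
- apply/ae_eqe_mul2l/integral_ae_eq => //; first exact: Radon_Nikodym_integrable.
  by move=> A _ mA; rewrite -Radon_Nikodym_integral//; case: gd => _ _ /(_ A mA).
Qed.

Lemma Rintegral_density f : bounded_measurable f ->
  \int[nu]_x f x = \int[mu]_x (f x * g x).
Proof.
move=> bf; rewrite /Rintegral integral_density//.
exact: bounded_measurable_integrable.
Qed.

Lemma bounded_density_integrable f : bounded_measurable f ->
  mu.-integrable setT (EFin \o (fun x => f x * g x)).
Proof.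
move=> [mf [M fM]]; apply: (@le_integrable _ _ _ _ _ measurableT _
  (fun x => (M%:E * (EFin \o g) x)%E)).
- by apply/measurable_EFinP; exact: measurable_funM.
- move=> x _; rewrite lee_fin !normrM ler_wpM2r//.
  exact: le_trans (fM x) (ler_norm _).
- by apply: integrableZl => //; exact: density_integrable.
Qed.

End density.

Section entropy.
Context (dd : measure_display) (T : measurableType dd) (R : realType).

Definition entropy (mu : {measure set T -> \bar R}) (g : T -> R) : \bar R :=
  (\int[mu]_x (g x * ln (g x))%:E)%E.

Definition log_laplace (mu : {measure set T -> \bar R}) (f : T -> R) : R :=
  ln (\int[mu]_x expR (f x)).

Lemma Rintegral_expR_gt0 (mu : probability T R) f : bounded_measurable f ->
  0 < \int[mu]_x expR (f x).
Proof.
move=> bf; have [_ [M fM]] := bf; apply: (lt_le_trans (expR_gt0 (- M))).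
rewrite -[leLHS](Rintegral_probability_cst mu); apply: le_Rintegral => //.
- exact: bounded_measurable_integrable (bounded_measurable_cst _ _).
- exact: bounded_measurable_integrable (bounded_measurable_expR _).
- by move=> x _; rewrite ler_expR; have := fM x; rewrite ler_norml => /andP[].
Qed.

Lemma expR_log_laplace (mu : probability T R) f : bounded_measurable f ->
  expR (log_laplace mu f) = \int[mu]_x expR (f x).
Proof. by move=> bf; rewrite lnK// posrE Rintegral_expR_gt0. Qed.

Lemma le_log_laplace (mu : probability T R) f h :
  bounded_measurable f -> bounded_measurable h -> (forall x, f x <= h x) ->
  log_laplace mu f <= log_laplace mu h.
Proof.
move=> bf bh fh; rewrite ler_ln ?posrE ?Rintegral_expR_gt0//.
apply: le_Rintegral => //.
- exact: bounded_measurable_integrable (bounded_measurable_expR _).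
- exact: bounded_measurable_integrable (bounded_measurable_expR _).
- by move=> x _; rewrite ler_expR.
Qed.

Lemma log_laplace_le_quadratic (mu : probability T R) f e :
  bounded_measurable f -> (forall x, `|f x| <= e) -> e <= 1/2 ->
  log_laplace mu f <= \int[mu]_x f x + 2 * e ^+ 2.
Proof.
move=> bf fe e12; rewrite -ler_expR expR_log_laplace//.
apply: le_trans (expR_ge1Dx _).
have b_cst := bounded_measurable_cst T (1 + 2 * e ^+ 2).
have -> : 1 + (\int[mu]_x f x + 2 * e ^+ 2) = \int[mu]_x (f x + (1 + 2 * e ^+ 2)).
  rewrite RintegralD ?Rintegral_probability_cst//; first by ring.
  - exact: bounded_measurable_integrable.
  - exact: bounded_measurable_integrable b_cst.
apply: le_Rintegral => //.
- exact: bounded_measurable_integrable (bounded_measurable_expR _).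
- exact: bounded_measurable_integrable (bounded_measurableD _ b_cst).
move=> x _; have f12 : f x <= 1/2 by exact: le_trans (ler_norm _) (le_trans (fe x) _).
apply: (le_trans (expR_le_quadratic f12)).
have : f x ^+ 2 <= e ^+ 2.
  by rewrite -(real_normK (num_real (f x))) lerXn2r ?nnegrE//; exact: le_trans (fe x).
lra.
Qed.

Definition tilted_density (mu : {measure set T -> \bar R}) (f : T -> R) (x : T) : R :=
  expR (f x - log_laplace mu f).

Section tilt.
Variables (mu : probability T R) (f : T -> R).
Hypothesis bf : bounded_measurable f.

Lemma bounded_measurable_tilted_density : bounded_measurable (tilted_density mu f).
Proof.
exact/bounded_measurable_expR/(bounded_measurableB bf)/bounded_measurable_cst.
Qed.

Lemma exists_tilted_probability :
  exists nu : probability T R, is_density mu nu (tilted_density mu f).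
Proof.
apply: exists_probability_density => [|x|]; last 2 first.
- exact: expR_ge0.
- rewrite integral_bounded_measurable; last exact: bounded_measurable_tilted_density.
  rewrite /tilted_density; under eq_Rintegral do rewrite expRB.
  rewrite RintegralZr//; last first.
    exact: bounded_measurable_integrable (bounded_measurable_expR _).
  by rewrite -expR_log_laplace// mulfV ?gt_eqF ?expR_gt0.
by case: bounded_measurable_tilted_density.
Qed.

Lemma log_laplaceD (nu : probability T R) (u : T -> R) :
  is_density mu nu (tilted_density mu f) -> bounded_measurable u ->
  log_laplace mu (fun x => f x + u x) = log_laplace mu f + log_laplace nu u.
Proof.
move=> fd bu; have beu := bounded_measurable_expR bu.
rewrite /log_laplace -lnM ?posrE ?Rintegral_expR_gt0//; congr ln.
rewrite (Rintegral_density fd beu) -RintegralZl//; last first.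
  exact: (bounded_density_integrable fd beu).
apply: eq_Rintegral => x _.
by rewrite -(expR_log_laplace mu bf) -!expRD; congr expR; ring.
Qed.

End tilt.

Lemma mul_le_xlnx_expR (r s : R) : 0 <= r -> s * r <= r * ln r - r + expR s.
Proof.
rewrite le0r => /orP[/eqP ->|r0]; first by have := expR_gt0 s; lra.
have := ler_wpM2l (ltW r0) (expR_ge1Dx (s - ln r)).
by rewrite expRB lnK// mulrCA mulfV ?gt_eqF//; lra.
Qed.

Section variational_formula.
Variables (mu nu : probability T R) (g : T -> R).
Hypothesis gd : is_density mu nu g.

Lemma donsker_varadhan_le f : bounded_measurable f ->
  ((\int[nu]_x f x - log_laplace mu f)%:E <= entropy mu g)%E.
Proof.
move=> bf; pose h x := f x - log_laplace mu f.
have bh : bounded_measurable h.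
  by apply: bounded_measurableB => //; exact: bounded_measurable_cst.
have int_eh := bounded_measurable_integrable mu (bounded_measurable_expR bh).
have int_g := density_integrable gd.
have int_hg := bounded_density_integrable gd bh.
have int_hgg : mu.-integrable setT (EFin \o (fun x => h x * g x + g x)).
  by apply: eq_integrable (integrableD _ int_hg int_g) => // x _; rewrite /= EFinD.
pose k x := h x * g x + g x - expR (h x).
have int_k : mu.-integrable setT (EFin \o k).
  by apply: eq_integrable (integrableB _ int_hgg int_eh) => // x _; rewrite /= EFinB.
have -> : \int[nu]_x f x - log_laplace mu f = \int[mu]_x k x.
  rewrite RintegralB// RintegralD// -(Rintegral_density gd)// (Rintegral_density1 gd).
  have [nuf fd] := exists_tilted_probability mu bf.
  rewrite [\int[mu]_x expR _](Rintegral_density1 fd) addrK RintegralB//.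
  - by rewrite Rintegral_probability_cst.
  - exact: bounded_measurable_integrable.
  - exact: bounded_measurable_integrable (bounded_measurable_cst _ _).
rewrite /Rintegral fineK; last exact: (integrable_fin_num measurableT int_k).
apply: le_integralT => x; rewrite lee_fin /k.
by have [_ /(_ x) g0 _] := gd; have := mul_le_xlnx_expR (h x) g0; lra.
Qed.

Lemma entropy_ge0 : (0 <= entropy mu g)%E.
Proof.
have := donsker_varadhan_le (bounded_measurable_cst T 0).
by rewrite /log_laplace !Rintegral_probability_cst expR0 ln1 subrr.
Qed.

End variational_formula.

Lemma donsker_varadhan_relent_le (mu nu : probability T R) f :
  bounded_measurable f ->
  ((\int[nu]_x f x - log_laplace mu f)%:E <= relent mu nu)%E.
Proof.
by move=> bf; apply: le_ereal_inf_tmp => _ [g gd <-]; exact: donsker_varadhan_le.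
Qed.

End entropy.

(** * Inf-convolutions and their slope *)

Section slope.
Context (R : realType) (dd : measure_display) (X : measurableType dd).
Variable d : X -> X -> R.
Implicit Types (f : X -> R) (x : X).

Lemma slope_ge0 f x : (0 <= slope d f x)%E.
Proof.
by apply: le_ereal_inf_tmp => _ [r _ <-]; apply: ereal_sup_ubound; left.
Qed.

Lemma slopeB_cst f k x : slope d (fun z => f z - k) x = slope d f x.
Proof.
congr ereal_inf; apply: eq_imagel => r _; congr (ereal_sup (_ `|` _)).
apply: eq_imagel => y _; congr ((Num.max _ _ / _)%:E); ring.
Qed.

Lemma slope_le f x (A K r : R) : 0 <= A -> 0 < r ->
  (forall z, 0 < d z x < r -> f z - f x <= (A + K * d z x) * d z x) ->
  (slope d f x <= A%:E)%E.
Proof.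
move=> A0 r0 fz; apply/lee_addgt0Pr => e e0.
have K0 : 0 < `|K| + 1 by rewrite ltr_wpDl.
pose s := Num.min r (e / (`|K| + 1)).
have s0 : 0 < s by rewrite lt_min r0 divr_gt0.
apply: ge_ereal_inf; exists (ereal_sup ([set 0%E] `|`
  [set ((Num.max (f y - f x) 0) / d y x)%:E | y in [set y | 0 < d y x < s]])).
  by exists s.
apply: ge_ereal_sup => _ [->|[z /andP[z0 zs] <-]].
  by rewrite -EFinD lee_fin addr_ge0// ltW.
move: zs; rewrite lt_min ltr_pdivlMr// => /andP[zr ze].
rewrite -EFinD lee_fin ler_pdivrMr// ge_max.
rewrite mulr_ge0 ?addr_ge0 ?(ltW e0) ?(ltW z0)// andbT.
rewrite (le_trans (fz z _)) ?z0// ler_pM2r// lerD2l.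
by have := ler_wpM2r (ltW z0) (ler_norm K); lra.
Qed.

End slope.

Definition infconv (R : realType) (T : Type) (d : T -> T -> R) (lam : R)
    (h : T -> R) (x : T) : R :=
  inf [set h y + lam * d x y ^+ 2 | y in [set: T]].

Section infconv.
Context (R : realType) (dd : measure_display) (X : measurableType dd).
Variables (d : X -> X -> R) (lam : R).
Hypotheses (d_metric : is_metric d) (lam_ge0 : 0 <= lam).

Let d_ge0 x y : 0 <= d x y. Proof. by case: d_metric. Qed.
Let dxx x : d x x = 0. Proof. by case: d_metric => _ h _ _; apply/h. Qed.
Let dC x y : d x y = d y x. Proof. by case: d_metric. Qed.
Let d_triangle x y z : d x z <= d x y + d y z. Proof. by case: d_metric. Qed.

Let cost_ge0 x y : 0 <= lam * d x y ^+ 2.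
Proof. by rewrite mulr_ge0// sqr_ge0. Qed.

Let cost_triangle x y z :
  lam * d z y ^+ 2 <= lam * d x y ^+ 2 + lam * (2 * d x y + d z x) * d z x.
Proof.
rewrite -mulrA -mulrDr ler_wpM2l//.
have : d z y ^+ 2 <= (d z x + d x y) ^+ 2 by rewrite lerXn2r ?nnegrE ?addr_ge0.
lra.
Qed.

Section bounded.
Variables (h : X -> R) (M : R).
Hypothesis hM : forall x, `|h x| <= M.

Let h_geN x : - M <= h x. Proof. by have := hM x; rewrite ler_norml => /andP[]. Qed.

Let has_inf_cost x : has_inf [set h y + lam * d x y ^+ 2 | y in [set: X]].
Proof.
split; first by exists (h x + lam * d x x ^+ 2), x.
by exists (- M) => _ [y _ <-]; rewrite -[- M]addr0 lerD.
Qed.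

Lemma infconv_le x y : infconv d lam h x <= h y + lam * d x y ^+ 2.
Proof. by apply: ge_inf; [case: (has_inf_cost x)|exists y]. Qed.

Lemma infconv_le_id x : infconv d lam h x <= h x.
Proof. by have := infconv_le x x; rewrite dxx expr0n/= mulr0 addr0. Qed.

Lemma infconv_ge x (c : R) :
  (forall y, c <= h y + lam * d x y ^+ 2) -> c <= infconv d lam h x.
Proof.
by move=> hc; apply: lb_le_inf; [case: (has_inf_cost x)|move=> _ [y _ <-]].
Qed.

Lemma infconv_adherent x (e : R) : 0 < e ->
  exists y, h y + lam * d x y ^+ 2 < infconv d lam h x + e.
Proof.
by move=> e0; have [_ [y _ <-] ?] := inf_adherent e0 (has_inf_cost x); exists y.
Qed.

Lemma infconv_bounded x : `|infconv d lam h x| <= M.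
Proof.
rewrite ler_norml infconv_ge => [|y]; last by rewrite -[- M]addr0 lerD.
by rewrite (le_trans (infconv_le_id x))// (le_trans (ler_norm _)).
Qed.

Lemma EFin_infconvB x (k : R) : (infconv d lam h x - k)%:E =
  ereal_inf [set (- (k - h y) + lam * d x y ^+ 2)%:E | y in [set: X]].
Proof.
apply/eqP; rewrite eq_le; apply/andP; split.
  apply: le_ereal_inf_tmp => _ [y _ <-]; rewrite lee_fin.
  by have := infconv_le x y; lra.
apply/lee_addgt0Pr => e e0; have [y ye] := infconv_adherent x e0.
apply: (@le_trans _ _ (- (k - h y) + lam * d x y ^+ 2)%:E).
  by apply: ereal_inf_lbound; exists y.
by rewrite -EFinD lee_fin; lra.
Qed.

(* an infimum of continuous functions is upper semicontinuous *)
Lemma dopen_infconv_lt (a : R) : dopen d [set x | infconv d lam h x < a].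
Proof.
move=> x /= xa.
have [|y ye] := infconv_adherent x (e := a - infconv d lam h x).
  by rewrite subr_gt0.
pose K := lam * (2 * d x y + 1) + 1.
have K0 : 0 < K by rewrite ltr_wpDl// mulr_ge0// addr_ge0// mulr_ge0.
exists (Num.min 1 ((a - (h y + lam * d x y ^+ 2)) / K)); split.
  by rewrite lt_min ltr01 divr_gt0// subr_gt0; lra.
move=> z; rewrite lt_min dC ltr_pdivlMr// => /andP[z1 z2] /=.
apply: (le_lt_trans (infconv_le z y)); have := cost_triangle x y z.
have : lam * (2 * d x y + d z x) * d z x <= lam * (2 * d x y + 1) * d z x.
  by rewrite ler_wpM2r// ler_wpM2l// lerD2l ltW.
by move: z2; have := d_ge0 z x; rewrite /K; lra.
Qed.

End bounded.

Lemma infconv_leD (h h' : X -> R) (M M' e : R) x :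
  (forall x, `|h x| <= M) -> (forall x, `|h' x| <= M') ->
  (forall y, h y <= h' y + e) -> infconv d lam h x <= infconv d lam h' x + e.
Proof.
move=> hM hM' hh'; rewrite -lerBlDr; apply: infconv_ge hM' _ _ _ => y.
by have := infconv_le hM x y; have := hh' y; lra.
Qed.

Lemma infconv_contract (h h' : X -> R) (M M' e : R) x :
  (forall x, `|h x| <= M) -> (forall x, `|h' x| <= M') ->
  (forall y, `|h y - h' y| <= e) ->
  `|infconv d lam h x - infconv d lam h' x| <= e.
Proof.
move=> hM hM' hh'; have hh'_itv y : - e <= h y - h' y <= e by rewrite -ler_norml.
have le_right : infconv d lam h x <= infconv d lam h' x + e.
  by apply: infconv_leD hM hM' _ => y; have := hh'_itv y; lra.
have le_left : infconv d lam h' x <= infconv d lam h x + e.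
  by apply: infconv_leD hM' hM _ => y; have := hh'_itv y; lra.
by rewrite ler_norml; apply/andP; split; lra.
Qed.

(* At a point where an almost optimal [y] satisfies [lam * d x y ^+ 2 <= S], moving
   [x] to [z] raises the infimum by about [2 * lam * d x y * d z x] at most. *)
Lemma sqr_slope_infconv_le (h : X -> R) (M S : R) x : 0 < lam ->
  (forall x, `|h x| <= M) ->
  (forall e, 0 < e -> exists2 y, h y + lam * d x y ^+ 2 < infconv d lam h x + e &
    lam * d x y ^+ 2 <= S + e) ->
  0 <= S /\ ((slope d (infconv d lam h) x) ^+ 2 <= (4 * lam * S)%:E)%E.
Proof.
move=> lam0 hM near_min.
have S0 : 0 <= S.
  by apply/ler_addgt0Pr => e /near_min[y _]; apply: le_trans.
split=> //; pose rho := Num.sqrt (S / lam).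
have rho0 : 0 <= rho by exact: sqrtr_ge0.
have lam_rho2 : lam * rho ^+ 2 = S.
  by rewrite sqr_sqrtr ?divr_ge0// mulrC divfK ?gt_eqF.
have slope_rho : (slope d (infconv d lam h) x <= (2 * lam * rho)%:E)%E.
  apply: (@slope_le _ _ _ _ _ _ _ (3 * lam + 1) 1) => //.
    by rewrite mulr_ge0 ?mulr_ge0.
  move=> z /andP[zx _]; set r := d z x in zx *.
  have [|y y_min yS] := near_min (Num.min 1 lam * r ^+ 2).
    by rewrite mulr_gt0 ?lt_min ?lam0 ?ltr01 ?exprn_gt0.
  have min_le1 : Num.min 1 lam * r ^+ 2 <= r ^+ 2.
    by rewrite ler_piMl ?sqr_ge0// ge_min lexx.
  have min_le_lam : Num.min 1 lam * r ^+ 2 <= lam * r ^+ 2.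
    by rewrite ler_wpM2r ?sqr_ge0// ge_min lexx orbT.
  have y_rho : d x y <= rho + r.
    rewrite -(@ler_pXn2r _ 2)// ?nnegrE ?addr_ge0// ?(ltW zx)//.
    rewrite -(ler_pM2l lam0) (le_trans yS)// -lam_rho2.
    have : 0 <= lam * (rho * r) by rewrite !mulr_ge0// ltW.
    by move: min_le_lam; lra.
  have := infconv_le hM z y; have := cost_triangle x y z; rewrite -/r.
  have : lam * d x y * r <= lam * (rho + r) * r.
    by rewrite ler_wpM2r ?(ltW zx)// ler_wpM2l.
  by move: y_min min_le1; lra.
have -> : 4 * lam * S = (2 * lam * rho) ^+ 2 by rewrite -lam_rho2; ring.
by rewrite EFin_expe !expe2 lee_pmul ?slope_ge0.
Qed.

(* [k |-> infconv (k * h) x] is concave, being an infimum of the affine functions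
   [k |-> k * h y + lam * d x y ^+ 2]; hence the intercept [lam * d x y ^+ 2] of the
   one that is active at [k] is at most that of the chord through [k] and [k']. *)
Definition chord_intercept (h : X -> R) (k k' : R) (x : X) : R :=
  (k' * infconv d lam (fun y => k * h y) x -
   k * infconv d lam (fun y => k' * h y) x) / (k' - k).

Lemma infconv_near_minimiser (h : X -> R) (M k k' : R) x :
  (forall x, `|h x| <= M) -> 0 < k -> k < k' ->
  forall e, 0 < e -> exists2 y,
    k * h y + lam * d x y ^+ 2 < infconv d lam (fun y => k * h y) x + e &
    lam * d x y ^+ 2 <= chord_intercept h k k' x + e.
Proof.
move=> hM k0 kk' e e0; have k'0 : 0 < k' by exact: lt_trans kk'.
have dk : 0 < k' - k by rewrite subr_gt0.
have khM j : 0 < j -> forall y, `|j * h y| <= j * M.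
  by move=> j0 y; rewrite normrM gtr0_norm// ler_pM2l.
pose s := e * ((k' - k) / k').
have s0 : 0 < s by rewrite mulr_gt0// divr_gt0.
have se : s <= e by rewrite ler_piMr ?(ltW e0)// ler_pdivrMr// mul1r gerBl ltW.
have [y y_min] := infconv_adherent (khM k k0) x s0.
exists y; first by apply: lt_le_trans y_min _; rewrite lerD2l.
have y_le := infconv_le (khM k' k'0) x y.
have -> : e = k' * s / (k' - k) by rewrite /s; field; rewrite !gt_eqF.
rewrite /chord_intercept -mulrDl ler_pdivlMr//.
have := ler_wpM2l (ltW k0) y_le; have := ler_wpM2l (ltW k'0) (ltW y_min); lra.
Qed.

End infconv.

Section polish.
Context (R : realType) (dd : measure_display) (X : measurableType dd).
Variable d : X -> X -> R.
Hypothesis d_polish : polish_borel d.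

Lemma polish_is_metric : is_metric d. Proof. by case: d_polish. Qed.

Lemma upper_semicontinuous_measurable (f : X -> R) :
  (forall a, dopen d [set x | f x < a]) -> measurable_fun [set: X] f.
Proof.
case: d_polish => _ _ _ mE f_usc mT.
apply: (measurability _ (RGenInftyO.measurableE R)) => // _ [_ [a ->] <-].
rewrite setTI (_ : f @^-1` `]-oo, a[ = [set x | f x < a]).
  by apply/mE; exact: sub_sigma_algebra.
by apply/seteqP; split => x /=; rewrite in_itv.
Qed.

Lemma measurable_dist y : measurable_fun [set: X] (d ^~ y).
Proof.
apply: upper_semicontinuous_measurable => a x /= xa.
exists (a - d x y); split; first by rewrite subr_gt0.
have [_ _ dC d_triangle] := polish_is_metric.
by move=> z xz; have := d_triangle z x y; rewrite (dC z x); lra.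
Qed.

Lemma measurable_dball y r : measurable [set x | d x y < r].
Proof.
have -> : [set x | d x y < r] = [set: X] `&` (d ^~ y) @^-1` `]-oo, r[.
  by apply/seteqP; split=> [x|x []] /=; rewrite in_itv.
by apply: measurable_dist => //; exact: measurable_itv.
Qed.

Lemma infconv_bounded_measurable (lam : R) (h : X -> R) : 0 <= lam ->
  bounded_measurable h -> bounded_measurable (infconv d lam h).
Proof.
move=> lam0 [_ [M hM]]; split; last first.
  by exists M => x; apply: infconv_bounded => //; exact: polish_is_metric.
apply: upper_semicontinuous_measurable => a.
exact: (dopen_infconv_lt polish_is_metric lam0 hM).
Qed.

End polish.

(** * From the log-Sobolev inequality to the dual form of T2 *)

Section log_sobolev.
Context (R : realType) (dd : measure_display) (X : measurableType dd).
Variables (d : X -> X -> R) (mu : probability X R).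

Definition restricted_log_sobolev (lam0 D : R) : Prop :=
  forall (nu : probability X R) (f : X -> R), inF d lam0 f ->
    (forall A, measurable A -> (nu A = \int[mu]_(x in A) (expR (f x))%:E)%E) ->
    (relent mu nu <= D%:E * fisher d mu f)%E.

(* By the Donsker-Varadhan formula this is the dual form of [T2 d mu lam^-1]. *)
Definition bobkov_goetze (lam : R) : Prop :=
  forall h, bounded_measurable h ->
    log_laplace mu (infconv d lam h) <= \int[mu]_x h x.

Lemma fisher_le (nu : probability X R) (f F : X -> R) :
  is_density mu nu (fun x => expR (f x)) -> bounded_measurable F ->
  (forall x, ((slope d f x) ^+ 2 <= (F x)%:E)%E) ->
  (fisher d mu f <= (\int[nu]_x F x)%:E)%E.
Proof.
move=> fd bF fF; rewrite (Rintegral_density fd)//.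
rewrite /Rintegral fineK; last first.
  exact: integrable_fin_num (bounded_density_integrable fd bF).
by apply: le_integralT => x; rewrite EFinM lee_wpmul2r ?lee_fin ?expR_ge0.
Qed.

Variables (lam0 D lam : R).
Hypotheses (d_polish : polish_borel d) (D_gt0 : 0 < D).
Hypotheses (lam_gt0 : 0 < lam) (lam_lt : lam < lam0) (D_lam : 4 * D * lam <= 1).
Hypothesis lsi : restricted_log_sobolev lam0 D.

Let dP := polish_is_metric d_polish.
Let lam_ge0 : 0 <= lam. Proof. exact: ltW. Qed.

Section potential.
Variables (h : X -> R) (M : R).
Hypotheses (bh : bounded_measurable h) (hM : forall x, `|h x| <= M).

Let f k := infconv d lam (fun y => k * h y).
Let L k := log_laplace mu (f k).

Let khM (k : R) x : `|k * h x| <= `|k| * M.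
Proof. by rewrite normrM ler_wpM2l. Qed.

Let bf k : bounded_measurable (f k).
Proof. by apply: infconv_bounded_measurable => //; exact: bounded_measurableZ. Qed.

Let f_lipschitz k k' x : k <= k' -> `|f k' x - f k x| <= (k' - k) * M.
Proof.
move=> kk'; apply: (infconv_contract d lam_ge0 x (khM k') (khM k)) => y.
by rewrite -mulrBl normrM ger0_norm ?subr_ge0// ler_wpM2l// subr_ge0.
Qed.

Let bounded_chord_intercept k k' :
  bounded_measurable (chord_intercept d lam h k k').
Proof.
apply: bounded_measurableM; last exact: bounded_measurable_cst.
by apply: bounded_measurableB; exact/bounded_measurableZ/bf.
Qed.

Let Rintegral_chord_intercept (nu : probability X R) k k' :
  \int[nu]_x chord_intercept d lam h k k' x =
  (k' * \int[nu]_x f k x - k * \int[nu]_x f k' x) / (k' - k).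
Proof.
have intf j := bounded_measurable_integrable nu (bf j).
have intZ i j := bounded_measurable_integrable nu (bounded_measurableZ i (bf j)).
rewrite -!RintegralZl// -RintegralB// -RintegralZr//.
apply: bounded_measurable_integrable.
by apply: bounded_measurableB; exact/bounded_measurableZ/bf.
Qed.

Let fisher_infconv_le (nu : probability X R) (k k' : R) : 0 < k -> k < k' ->
  is_density mu nu (tilted_density mu (f k)) ->
  (D%:E * fisher d mu (fun x => f k x - L k)%R <=
   (\int[nu]_x chord_intercept d lam h k k' x)%:E)%E.
Proof.
move=> k0 kk' nu_tilt; pose S := chord_intercept d lam h k k'.
have bS : bounded_measurable S by exact: bounded_chord_intercept.
have slopeS x := sqr_slope_infconv_le dP lam_ge0 lam_gt0 (khM k)
  (infconv_near_minimiser d lam_ge0 x hM k0 kk').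
have fisher_le_S : (fisher d mu (fun x => f k x - L k)%R <=
    (\int[nu]_x (4 * lam * S x))%:E)%E.
  apply: fisher_le nu_tilt _ _ => [|x]; first exact: bounded_measurableZ.
  by rewrite slopeB_cst; case: (slopeS x).
apply: (le_trans (lee_wpmul2l _ fisher_le_S)); first by rewrite lee_fin ltW.
rewrite -EFinM lee_fin RintegralZl//; last exact: bounded_measurable_integrable.
rewrite !mulrA (mulrC D) -[leRHS]mul1r ler_wpM2r//.
by apply: Rintegral_ge0 => x _; case: (slopeS x).
Qed.

Let lsi_increment_le (nu : probability X R) (k k' : R) : 0 < k -> k < k' ->
  is_density mu nu (tilted_density mu (f k)) ->
  k * (\int[nu]_x (f k' x - f k x)) <= (k' - k) * L k.
Proof.
move=> k0 kk' nu_tilt; have dk : 0 < k' - k by rewrite subr_gt0.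
have fF : inF d lam0 (fun x => f k x - L k).
  exists (fun y => L k - k * h y), lam; split; first by rewrite lam_gt0.
  by move=> x; exact: (EFin_infconvB d lam_ge0 (khM k)).
have intf j := bounded_measurable_integrable nu (bf j).
have := le_trans (donsker_varadhan_relent_le mu nu (bf k))
  (le_trans (lsi fF _) (fisher_infconv_le k0 kk' nu_tilt)).
rewrite lee_fin => main; have {main} : \int[nu]_x f k x - L k <=
    (k' * \int[nu]_x f k x - k * \int[nu]_x f k' x) / (k' - k).
  by rewrite -Rintegral_chord_intercept main//; case: nu_tilt.
by rewrite ler_pdivlMr// RintegralB//; lra.
Qed.

Let log_laplace_infconv_step k k' : 0 < k -> k < k' -> (k' - k) * M <= 1/2 ->
  L k' / k' <= L k / k + 2 * M ^+ 2 / k' * (k' - k) ^+ 2.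
Proof.
move=> k0 kk' small; have k'0 : 0 < k' by exact: lt_trans kk'.
have [nu nu_tilt] := exists_tilted_probability mu (bf k).
have bu : bounded_measurable (fun x => f k' x - f k x) by exact: bounded_measurableB.
have LE : L k' = L k + log_laplace nu (fun x => f k' x - f k x).
  rewrite -(log_laplaceD (bf k) nu_tilt bu); congr log_laplace.
  by apply/funext => x; rewrite subrKC.
have := log_laplace_le_quadratic nu bu (fun x => f_lipschitz x (ltW kk')) small.
have := lsi_increment_le k0 kk' nu_tilt.
rewrite mulrC -ler_pdivlMr// => incr log_le.
rewrite ler_pdivrMr//.
rewrite (_ : _ * k' = L k + (k' - k) * L k / k + 2 * ((k' - k) * M) ^+ 2).
  by rewrite LE -addrA lerD2l (le_trans log_le)// lerD2r.
by field; rewrite !gt_eqF.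
Qed.

Let log_laplace_infconvZ_le a : 0 < a -> a * M <= 1/2 ->
  L a <= a * (\int[mu]_x h x + 2 * M ^+ 2 * a).
Proof.
move=> a0 small; have bah := bounded_measurableZ a bh.
have fa_le x : f a x <= a * h x by exact: (infconv_le_id dP lam_ge0 (khM a)).
apply: (le_trans (le_log_laplace mu (bf a) bah fa_le)).
apply: (le_trans (log_laplace_le_quadratic mu bah _ small)) => [x|].
  by rewrite (le_trans (khM a x))// gtr0_norm.
rewrite RintegralZl//; last exact: bounded_measurable_integrable.
by rewrite mulrDr exprMn; lra.
Qed.

Hypothesis M_ge0 : 0 <= M.

Let log_laplace_infconv_le_quotient a : 0 < a -> a <= 1 -> L 1 <= L a / a.
Proof.
move=> a0 a1; rewrite -[L 1]divr1.
apply: (@nonincreasing_of_quadratic_defect _ (fun k => L k / k) _ _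
  (2 * M ^+ 2 / a) (2 * M + 1)^-1) => // [|s t as_ st _].
  by rewrite invr_gt0 ltr_wpDl// mulr_ge0.
have s0 : 0 < s by exact: lt_le_trans as_.
move=> st_small; apply: le_trans (log_laplace_infconv_step s0 st _) _.
  apply: (le_trans (ler_wpM2r M_ge0 st_small)).
  by rewrite mulrC ler_pdivrMr ?ltr_wpDl ?mulr_ge0//; lra.
rewrite lerD2l ler_wpM2r ?sqr_ge0// ler_wpM2l ?mulr_ge0 ?sqr_ge0//.
have a_le_t := le_trans as_ (ltW st).
by rewrite lef_pV2 ?posrE// (lt_le_trans a0).
Qed.

Lemma log_laplace_infconv_le : log_laplace mu (infconv d lam h) <= \int[mu]_x h x.
Proof.
have -> : infconv d lam h = f 1.
  by congr infconv; apply/funext => x; rewrite mul1r.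
apply/ler_addgt0Pr => e e0.
pose K := 2 * M + 2 * M ^+ 2 / e + 1.
have defect_ge0 : 0 <= 2 * M ^+ 2 / e by rewrite !mulr_ge0 ?sqr_ge0 ?invr_ge0// ltW.
have K_ge1 : 1 <= K by rewrite lerDr addr_ge0// mulr_ge0.
have M_le_K : 2 * M <= K by rewrite /K -addrA lerDl addr_ge0.
have defect_le_K : 2 * M ^+ 2 / e <= K by rewrite /K addrAC lerDr addr_ge0// mulr_ge0.
have K_gt0 : 0 < K by exact: lt_le_trans K_ge1.
have KV_gt0 : 0 < K^-1 by rewrite invr_gt0.
apply: (le_trans (log_laplace_infconv_le_quotient KV_gt0 _)); first by rewrite invf_le1.
rewrite ler_pdivrMr// mulrC (le_trans (log_laplace_infconvZ_le KV_gt0 _))//.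
  by rewrite mulrC ler_pdivrMr//; lra.
by rewrite ler_pM2l// lerD2l ler_pdivrMr// (mulrC e) -ler_pdivrMr.
Qed.

End potential.

Lemma bobkov_goetze_of_log_sobolev : bobkov_goetze lam.
Proof.
move=> h bh; have [_ [M hM]] := bh.
have hNM x : `|h x| <= `|M| by exact: le_trans (hM x) (ler_norm _).
exact: log_laplace_infconv_le bh hNM (normr_ge0 M).
Qed.

End log_sobolev.

(** * Dual values and second moments *)

Section truncation.
Context (R : realType) (dd : measure_display) (T : measurableType dd).
Variables (P : probability T R) (f : T -> R).
Hypotheses (mf : measurable_fun [set: T] f) (f_ge0 : forall x, 0 <= f x).

Lemma integrable_of_truncations (K : R) :
  (forall n : nat, \int[P]_x Num.min (f x) n%:R <= K) ->
  P.-integrable setT (EFin \o f).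
Proof.
move=> fK; have bf n := bounded_measurable_min n mf f_ge0.
have nd_min x : {homo (fun n : nat => (Num.min (f x) n%:R)%:E) :
    m n / (m <= n)%N >-> (m <= n)%E}.
  move=> m n mn; rewrite lee_fin le_min !ge_min lexx/=.
  by rewrite ler_nat mn orbT.
apply/integrableP; split; first exact/measurable_EFinP.
under eq_integral do rewrite /= ger0_norm//.
rewrite (_ : (fun x => (f x)%:E) =
    (fun x => limn (fun n => (Num.min (f x) n%:R)%:E))); last first.
  apply/funext => x; apply/esym/cvg_lim => //; apply: cvg_near_cst.
  exists (Num.truncn (f x)).+1 => // n /= fn; congr (_%:E); apply/min_idPl.
  by rewrite (le_trans (ltW (truncnS_gt (f x))))// ler_nat.
rewrite monotone_convergence//.
- apply: (@le_lt_trans _ _ K%:E); last exact: ltry.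
  apply: lime_le; last first.
    by apply: nearW => n; rewrite integral_bounded_measurable// lee_fin.
  apply: ereal_nondecreasing_is_cvgn => m n mn; apply: le_integralT => x.
  exact: nd_min.
- by move=> n; apply/measurable_EFinP; case: (bf n%:R).
- by move=> n x _; rewrite lee_fin le_min f_ge0 ler0n.
Qed.

End truncation.

Section duality.
Context (R : realType) (dd : measure_display) (X : measurableType dd).
Variables (d : X -> X -> R) (mu : probability X R) (lam : R).
Hypotheses (d_polish : polish_borel d) (lam_gt0 : 0 < lam).
Hypothesis mu_bg : bobkov_goetze d mu lam.

Let dP := polish_is_metric d_polish.
Let lam_ge0 : 0 <= lam. Proof. exact: ltW. Qed.
Let d_ge0 x y : 0 <= d x y. Proof. by case: dP. Qed.
Let dC x y : d x y = d y x. Proof. by case: dP. Qed.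
Let d_triangle x y z : d x z <= d x y + d y z. Proof. by case: dP. Qed.

Let cost_ge0 (c : R) x y : 0 <= c -> 0 <= c * d x y ^+ 2.
Proof. by move=> c0; rewrite mulr_ge0// sqr_ge0. Qed.

(* Truncating [psi] at the upper bound [N] of [phi] preserves the constraint, and
   makes [psi] bounded. *)
Lemma dual_value_le_entropy (nu : probability X R) (g phi psi : X -> R) (N : R) :
  is_density mu nu g ->
  nu.-integrable setT (EFin \o phi) -> mu.-integrable setT (EFin \o psi) ->
  (forall x, phi x <= N) -> (forall y, - N <= psi y) ->
  (forall x y, phi x <= psi y + lam * d x y ^+ 2) ->
  ((\int[nu]_x phi x - \int[mu]_x psi x)%:E <= entropy mu g)%E.
Proof.
move=> gd iphi ipsi phiN psiN phi_psi.
pose h y := Num.min (psi y) N.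
have hN y : `|h y| <= `|N|.
  rewrite /h minEle; case: ifPn => // psi_le.
  rewrite ler_norml (le_trans psi_le) ?ler_norm// andbT.
  by rewrite (le_trans _ (psiN y))// lerN2 ler_norm.
have bh : bounded_measurable h.
  split; last by exists `|N|.
  by apply: measurable_minr => //; exact/measurable_EFinP/(measurable_int mu).
have bQ := infconv_bounded_measurable d_polish lam_ge0 bh.
apply: le_trans (donsker_varadhan_le gd bQ); rewrite lee_fin lerB//.
  apply: le_Rintegral => // [|x _]; first exact: bounded_measurable_integrable.
  apply: (infconv_ge lam_ge0 hN) => y.
  rewrite -lerBlDr le_min lerBlDr phi_psi/=.
  by rewrite (le_trans _ (phiN x))// gerBl cost_ge0.
apply: (le_trans (mu_bg bh)); apply: le_Rintegral => // [|y _].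
  exact: bounded_measurable_integrable.
by rewrite ge_min lexx.
Qed.

Section second_moment.
Variable x0 : X.

Let cut (c : R) (n : nat) x : R := Num.min (c * d x x0 ^+ 2) n%:R.

Let measurable_sqr_dist c : measurable_fun [set: X] (fun x => c * d x x0 ^+ 2).
Proof.
by apply: measurable_funM => //; apply: measurable_funX; exact: measurable_dist.
Qed.

Let bounded_cut (c : R) n : 0 <= c -> bounded_measurable (cut c n).
Proof. by move=> c0; apply: bounded_measurable_min => // x; exact: cost_ge0. Qed.

Let cut_le n x y : cut (lam / 2) n x <= cut lam n y + lam * d x y ^+ 2.
Proof.
rewrite -lerBlDr le_min; apply/andP; split; last first.
  by rewrite lerBlDr ge_min lerDl cost_ge0 ?orbT.
rewrite lerBlDr ge_min; apply/orP; left.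
have xy : d x x0 ^+ 2 <= (d y x0 + d x y) ^+ 2.
  by rewrite lerXn2r ?nnegrE ?addr_ge0// addrC.
have := mulr_ge0 lam_ge0 (sqr_ge0 (d y x0 - d x y)).
by have := ler_wpM2l lam_ge0 xy; lra.
Qed.

Let integrable_sqr_dist_of_cut (P : probability X R) (K : R) :
  (forall n, \int[P]_x cut (lam / 2) n x <= K) ->
  P.-integrable setT (EFin \o (fun x => d x x0 ^+ 2)).
Proof.
move=> PK; have half_lam_ge0 : 0 <= lam / 2 by rewrite divr_ge0.
have := integrable_of_truncations (measurable_sqr_dist _)
  (fun x => cost_ge0 x x0 half_lam_ge0) PK.
move=> /(integrableZl measurableT (2 / lam)); apply: eq_integrable => // x _ /=.
by rewrite -EFinM; congr (_%:E); field; rewrite gt_eqF.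
Qed.

Section density.
Variables (nu : probability X R) (g : X -> R) (H : R).
Hypotheses (gd : is_density mu nu g) (gH : entropy mu g = H%:E).

Let half_lam_ge0 : 0 <= lam / 2. Proof. by rewrite divr_ge0. Qed.

Let integrable_cut (P : probability X R) c n : 0 <= c ->
  P.-integrable setT (EFin \o cut c n).
Proof. by move=> c0; exact/bounded_measurable_integrable/bounded_cut. Qed.

Let cut_ge0 c n x : 0 <= c -> 0 <= cut c n x.
Proof. by move=> c0; rewrite le_min cost_ge0/=. Qed.

Let cut_le_bound c n x : cut c n x <= n%:R.
Proof. by rewrite ge_min lexx orbT. Qed.

Let Rintegral_cut_density_le n :
  \int[nu]_x cut (lam / 2) n x <= H + \int[mu]_x cut lam n x.
Proof.
rewrite -lerBlDr -lee_fin -gH.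
apply: (dual_value_le_entropy (N := n%:R) gd); [exact: integrable_cut..| | |].
- by move=> x; exact: cut_le_bound.
- by move=> y; rewrite (@le_trans _ _ 0) ?oppr_le0 ?cut_ge0.
- exact: cut_le.
Qed.

Let Rintegral_cut_le_density n :
  \int[mu]_x cut (lam / 2) n x <= H + \int[nu]_x cut lam n x.
Proof.
have RintegralN (P : probability X R) c : 0 <= c ->
    \int[P]_x - cut c n x = - \int[P]_x cut c n x.
  move=> c0; under eq_Rintegral do rewrite -mulN1r.
  by rewrite RintegralZl ?mulN1r//; exact: integrable_cut.
have integrableN (P : probability X R) c : 0 <= c ->
    P.-integrable setT (EFin \o (fun x => - cut c n x)).
  by move=> c0; exact/bounded_measurable_integrable/bounded_measurableN/bounded_cut.
rewrite -lerBlDr addrC -[X in _ + X]opprK -!RintegralN// -lee_fin -gH.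
apply: (dual_value_le_entropy (N := n%:R) gd); [exact: integrableN..| | |].
- by move=> x; rewrite (@le_trans _ _ 0) ?oppr_le0 ?cut_ge0.
- by move=> y; rewrite lerN2 cut_le_bound.
- by move=> x y; have := cut_le n y x; rewrite (dC x y); lra.
Qed.

Lemma integrable_sqr_dist_density :
  mu.-integrable setT (EFin \o (fun x => d x x0 ^+ 2)) ->
  nu.-integrable setT (EFin \o (fun x => d x x0 ^+ 2)).
Proof.
move=> mu_moment.
apply: (integrable_sqr_dist_of_cut (K := H + lam * \int[mu]_x d x x0 ^+ 2)) => n.
rewrite (le_trans (Rintegral_cut_density_le n))// lerD2l -RintegralZl//.
apply: le_Rintegral => // [||x _]; first exact: integrable_cut.
  by apply: eq_integrable (integrableZl _ lam mu_moment).
by rewrite ge_min lexx.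
Qed.

Lemma integrable_sqr_dist_of_ball_density r : (forall x, g x != 0 -> d x x0 < r) ->
  mu.-integrable setT (EFin \o (fun x => d x x0 ^+ 2)).
Proof.
move=> gr; apply: (integrable_sqr_dist_of_cut (K := H + lam * r ^+ 2)) => n.
rewrite (le_trans (Rintegral_cut_le_density n))// lerD2l.
rewrite (Rintegral_density gd); last exact: bounded_cut.
rewrite -[leRHS]mulr1 -(Rintegral_density1 gd) -RintegralZl//; last first.
  exact: density_integrable gd.
apply: le_Rintegral => // [||x _].
- exact: (bounded_density_integrable gd (bounded_cut _ _)).
- exact: integrableZl (density_integrable gd).
have [_ /(_ x) g0 _] := gd; have [->|gx] := eqVneq (g x) 0; first by rewrite !mulr0.
rewrite ler_wpM2r// ge_min ler_wpM2l// lerXn2r ?nnegrE//; last exact/ltW/gr.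
exact: le_trans (ltW (gr x gx)).
Qed.

End density.

Let exists_ball_neq0 : exists n : nat, mu [set x | d x x0 < n%:R] != 0%E.
Proof.
apply: contrapT => /forallNP ball0.
suff: mu [set: X] = 0%E by rewrite probability_setT => /eqP; rewrite onee_eq0.
apply/negligibleP => //.
rewrite (_ : [set: X] = \bigcup_n [set x | d x x0 < n%:R]).
  apply: negligible_bigcup => n; apply/negligibleP; last first.
    by apply: contrapT => /eqP /(ball0 n).
  exact: measurable_dball.
apply/seteqP; split=> // x _; exists (Num.truncn (d x x0)).+1 => //=.
exact: truncnS_gt.
Qed.

(* Apply the duality to [mu] conditioned on a ball, whose entropy is finite. *)
Lemma integrable_sqr_dist : mu.-integrable setT (EFin \o (fun x => d x x0 ^+ 2)).
Proof.
have [n Bn] := exists_ball_neq0; set B := [set x | d x x0 < n%:R] in Bn.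
have mB : measurable B by exact: measurable_dball.
pose k := (fine (mu B))^-1; have k0 : 0 <= k by rewrite invr_ge0 fine_ge0.
have bZ (l : R) : bounded_measurable (fun x => l * \1_B x).
  exact/bounded_measurableZ/bounded_measurable_indic.
pose g x := k * \1_B x.
have g0 x : 0 <= g x by rewrite mulr_ge0// indicE.
have g1 : (\int[mu]_x (g x)%:E = 1)%E.
  rewrite integral_bounded_measurable; last exact: bZ.
  rewrite RintegralZl//; last first.
    exact/bounded_measurable_integrable/bounded_measurable_indic.
  rewrite /Rintegral integral_indic// setIT mulVf//.
  by rewrite fine_eq0// fin_num_measure.
have [nu gd] := exists_probability_density (proj1 (bZ k)) g0 g1.
have gE x : g x * ln (g x) = k * ln k * \1_B x.
  rewrite /g indicE; case: (x \in B); first by rewrite !mulr1.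
  by rewrite !mulr0 mul0r.
have gH : entropy mu g = (\int[mu]_x (k * ln k * \1_B x))%:E.
  rewrite -integral_bounded_measurable; last exact: bZ.
  by apply: eq_integral => x _; rewrite gE.
apply: (integrable_sqr_dist_of_ball_density gd gH (r := n%:R)) => x.
rewrite /g indicE; have [/set_mem//|] := boolP (x \in B).
by rewrite mulr0 eqxx.
Qed.

End second_moment.
End duality.

(** * Quantisation *)

Definition quantisation_error (R : realType) (T I : Type) (d : T -> T -> R)
    (t : T -> I) (pt : I -> T) (x : T) : R := d x (pt (t x)) ^+ 2.

Section quantisation.
Context (R : realType) (dd : measure_display) (X : measurableType dd).
Variable d : X -> X -> R.
Hypothesis d_polish : polish_borel d.

Let d_ge0 x y : 0 <= d x y. Proof. by case: (polish_is_metric d_polish). Qed.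

Section cells.
Variables (s : nat -> X) (r : R).
Hypothesis r_gt0 : 0 < r.

(* the last index [i < n] with [d x (s i) < r], and [0] when there is none *)
Fixpoint cell (n : nat) (x : X) : nat :=
  if n is m.+1 then if d x (s m) < r then m else cell m x else 0.

Lemma cell_lt n x : (cell n x < n.+1)%N.
Proof. by elim: n => //= n IH; case: ifP => // _; exact: ltnW. Qed.

Lemma measurable_cell (dd' : measure_display) (Y : measurableType dd')
    (F : nat -> X -> Y) n : (forall i, measurable_fun [set: X] (F i)) ->
  measurable_fun [set: X] (fun x => F (cell n x) x).
Proof.
move=> mF; elim: n => [|n IH] /=; first exact: mF.
rewrite (_ : (fun x => _) =
  (fun x => if d x (s n) < r then F n x else F (cell n x) x)); last first.
  by apply/funext => x; case: ifP.
apply: measurable_fun_ifT => //; apply: measurable_fun_ltr => //.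
exact: measurable_dist.
Qed.

Lemma measurable_cell_fibre n i : measurable [set x | cell n x = i].
Proof.
have := @measurable_cell _ nat (fun i _ => i) n (fun i => measurable_cst _).
by move=> /(_ measurableT [set i] I); rewrite setTI.
Qed.

Let err n := quantisation_error d (cell n) s.

Lemma measurable_cell_error n : measurable_fun [set: X] (err n).
Proof.
apply: (@measurable_cell _ R (fun i x => d x (s i) ^+ 2)) => i.
by apply: measurable_funX; exact: measurable_dist.
Qed.

Lemma cell_error_le n x : err n x <= r ^+ 2 + d x (s 0) ^+ 2.
Proof.
rewrite /err /quantisation_error; elim: n => [|n IH] /=.
  by rewrite lerDr sqr_ge0.
case: ifPn => // xn; apply: (@le_trans _ _ (r ^+ 2)); last by rewrite lerDl sqr_ge0.
by apply: lerXn2r; rewrite ?nnegrE// ltW.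
Qed.

Lemma cell_error_small n x m : (m < n)%N -> d x (s m) < r -> err n x <= r ^+ 2.
Proof.
rewrite /err /quantisation_error => + xm; elim: n => //= n IH; rewrite ltnS leq_eqVlt.
case: ifPn => [xn _|xn]; first by apply: lerXn2r; rewrite ?nnegrE// ltW.
by case/orP => [/eqP mn|//]; move: xn; rewrite -mn xm.
Qed.

Variable P : probability X R.
Hypothesis P2 : P.-integrable setT (EFin \o (fun x => d x (s 0) ^+ 2)).

Let integrable_cst (k : R) : P.-integrable setT (EFin \o (fun=> k)).
Proof. exact/bounded_measurable_integrable/bounded_measurable_cst. Qed.

Lemma integrable_cell_error n : P.-integrable setT (EFin \o err n).
Proof.
apply: le_integrable (integrableD _ (integrable_cst (r ^+ 2)) P2) => //.
  exact/measurable_EFinP/measurable_cell_error.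
move=> x _; rewrite /= lee_fin !ger0_norm ?addr_ge0 ?sqr_ge0//.
exact: cell_error_le.
Qed.

Hypothesis dense : forall x, exists n, d x (s n) < r.

(* Beyond [r ^+ 2] the error is dominated by [d x (s 0) ^+ 2], and it vanishes at [x]
   as soon as [n] exceeds the index of a point of [s] close to [x]. *)
Lemma Rintegral_cell_error_near :
  \forall n \near \oo, \int[P]_x err n x <= 2 * r ^+ 2.
Proof.
pose f n x := Num.max (err n x - r ^+ 2) 0.
have f_ge0 n x : 0 <= f n x by rewrite le_max lexx orbT.
have f_le n x : f n x <= d x (s 0) ^+ 2.
  by rewrite ge_max sqr_ge0 andbT; have := cell_error_le n x; lra.
have mf n : measurable_fun [set: X] (EFin \o f n).
  apply/measurable_EFinP/measurable_maxr => //; apply: measurable_funB => //.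
  exact: measurable_cell_error.
have f_cvg : {ae P, forall x, [set: X] x ->
    (EFin \o f n) x @[n --> \oo] --> cst 0%E x}.
  apply: aeW => x _; have [m xm] := dense x; apply: cvg_near_cst.
  exists m.+1 => // n /= mn; congr (_%:E); apply/max_idPr; rewrite subr_le0.
  exact: cell_error_small mn xm.
have f_dominated : {ae P, forall x n, [set: X] x ->
    (`|(EFin \o f n) x| <= (EFin \o (fun x => d x (s 0) ^+ 2)%R) x)%E}.
  by apply: aeW => x n _; rewrite lee_fin ger0_norm.
have [_ _] := dominated_convergence measurableT mf (measurable_cst _) f_cvg P2
  f_dominated.
rewrite integral0 => /fine_cvgP[_ /cvgrPdist_lt /(_ (r ^+ 2))].
rewrite exprn_gt0// => /(_ isT); apply: filterS => n /=.
rewrite sub0r normrN => /(le_lt_trans (ler_norm _))/ltW f_small.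
have if_ : P.-integrable setT (EFin \o f n).
  apply: le_integrable P2 => // x _.
  by rewrite lee_fin !ger0_norm ?sqr_ge0.
apply: (@le_trans _ _ (\int[P]_x (f n x + r ^+ 2))).
  apply: le_Rintegral => // [||x _]; first exact: integrable_cell_error.
    by apply: eq_integrable (integrableD _ if_ (integrable_cst _)).
  by rewrite -lerBlDr le_max lexx.
by rewrite RintegralD// Rintegral_probability_cst mulr2n mulrDl mul1r lerD2r.
Qed.

End cells.

Lemma exists_dense_sequence : [set: X] !=set0 ->
  exists s : nat -> X, forall (r : R) x, 0 < r -> exists n, d x (s n) < r.
Proof.
move=> [x0 _]; case: d_polish => _ _ [S [/countable_injP[f f_inj] S_dense]] _.
exists (fun n => xget x0 [set y | S y /\ f y = n]) => r x r0.
have [y [Sy xy]] := S_dense x r r0; exists (f y).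
case: xgetP => [z _ [Sz fz]|/(_ y) []//].
by rewrite (f_inj z y)// inE.
Qed.

Definition quantises (P : probability X R) (I : Type) (t : X -> I) (pt : I -> X)
    (e : R) : Prop :=
  P.-integrable setT (EFin \o quantisation_error d t pt) /\
  \int[P]_x quantisation_error d t pt x <= e.

Lemma exists_quantisation (P Q : probability X R) (e : R) : 0 < e ->
  (forall x0, P.-integrable setT (EFin \o (fun x => d x x0 ^+ 2))) ->
  (forall x0, Q.-integrable setT (EFin \o (fun x => d x x0 ^+ 2))) ->
  exists n (t : X -> 'I_n.+1) (pt : 'I_n.+1 -> X),
    [/\ forall i, measurable (t @^-1` [set i]), quantises P t pt e &
        quantises Q t pt e].
Proof.
move=> e0 P2 Q2; pose r := Num.sqrt (e / 2).
have r0 : 0 < r by rewrite sqrtr_gt0 divr_gt0.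
have r2 : 2 * r ^+ 2 = e by rewrite sqr_sqrtr ?divr_ge0 ?ltW// mulrC divfK.
have X0 : [set: X] !=set0.
  apply/set0P/eqP => X0; have := probability_setT P.
  by rewrite X0 measure0 => /eqP; rewrite eq_sym onee_eq0.
have [s s_dense] := exists_dense_sequence X0.
have dense x : exists n, d x (s n) < r by exact: s_dense.
have [n _ /(_ n (leqnn n)) [Pn Qn]] := filterI
  (Rintegral_cell_error_near r0 (P2 _) dense)
  (Rintegral_cell_error_near r0 (Q2 _) dense).
rewrite r2 in Pn Qn; exists n, (fun x => Ordinal (cell_lt s r n x)), (fun i => s i).
split=> [i||].
- rewrite (_ : _ @^-1` _ = [set x | cell s r n x = i]).
    exact: measurable_cell_fibre.
  by apply/seteqP; split=> x /= => [<-//|?]; exact: val_inj.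
- by split=> //; exact: (integrable_cell_error r0 (P2 _) n).
- by split=> //; exact: (integrable_cell_error r0 (Q2 _) n).
Qed.

End quantisation.

(** * Couplings from finite transport plans *)

Definition fibre_mass (R : realType) (T I : Type) (P : set T -> \bar R) (t : T -> I)
    (i : I) : R := fine (P (t @^-1` [set i])).

Section fibres.
Context (R : realType) (dd : measure_display) (T : measurableType dd).
Variables (I : finType) (t : T -> I).
Hypothesis mt : forall i, measurable (t @^-1` [set i]).

Lemma sum_fibre_indic (v : I -> R) x :
  \sum_i v i * \1_(t @^-1` [set i]) x = v (t x).
Proof.
rewrite (bigD1 (t x))//= big1 => [|i /eqP ti].
  by rewrite indicE mem_set//= mulr1 addr0.
by rewrite indicE memNset ?mulr0//= => /esym.
Qed.

Lemma bounded_measurable_fibre (v : I -> R) :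
  bounded_measurable (fun x => v (t x)).
Proof.
split; last first.
  by exists (\sum_i `|v i|) => x; exact: (ler_sumr_term (F := fun i => `|v i|)).
rewrite (_ : (fun x => v (t x)) =
    (fun x => \sum_i v i * \1_(t @^-1` [set i]) x)); last first.
  by apply/funext => x; rewrite sum_fibre_indic.
apply: measurable_sum => i; apply: measurable_funM; first exact: measurable_cst.
exact: (measurable_indic (mt i)).
Qed.

Lemma integral_fibre (P : {measure set T -> \bar R}) (v : I -> R) (E : set T) :
  measurable E -> (P E < +oo)%E -> (\int[P]_(x in E) (v (t x))%:E =
    \sum_i (v i)%:E * P (t @^-1` [set i] `&` E))%E.
Proof.
move=> mE E_fin; under eq_integral do rewrite -sum_fibre_indic -sumEFin.
have indic_int i : P.-integrable E (EFin \o \1_(t @^-1` [set i])).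
  apply: measurable_bounded_integrable => //.
  exists 1; split=> // y y1 x _; apply: le_trans (ltW y1); rewrite indicE.
  by case: (x \in _); rewrite ?normr1 ?normr0.
rewrite integral_sum//; last first.
  by move=> i; exact: (integrableZl mE (v i) (indic_int i)).
apply: eq_bigr => i _; under eq_integral do rewrite EFinM.
by rewrite (integralZl mE (indic_int i)) -integral_indic.
Qed.

Variable P : probability T R.

Lemma sum_fibre_measure E : measurable E ->
  \sum_i fine (P (t @^-1` [set i] `&` E)) = fine (P E).
Proof.
move=> mE; apply: EFin_inj; rewrite fineK ?fin_num_measure// -sumEFin.
have E_fin : (P E < +oo)%E by rewrite ltey_eq fin_num_measure.
have := integral_fibre (fun=> 1) mE E_fin; rewrite integral_cst// mul1e => ->.
apply: eq_bigr => i _; rewrite mul1e fineK// fin_num_measure//.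
exact: measurableI.
Qed.

Lemma fibre_mass_ge0 i : 0 <= fibre_mass P t i. Proof. exact: fine_ge0. Qed.

Lemma sum_fibre_mass : \sum_i fibre_mass P t i = 1.
Proof.
transitivity (fine (P setT)); last by rewrite probability_setT.
by rewrite -(sum_fibre_measure measurableT); apply: eq_bigr => i _; rewrite setIT.
Qed.

Lemma Rintegral_fibre (v : I -> R) :
  \int[P]_x v (t x) = \sum_i fibre_mass P t i * v i.
Proof.
apply: EFin_inj; rewrite -integral_bounded_measurable; last first.
  exact: bounded_measurable_fibre.
rewrite integral_fibre ?ltey_eq ?fin_num_measure// -sumEFin; apply: eq_bigr => i _.
by rewrite setIT EFinM /fibre_mass fineK ?fin_num_measure// muleC.
Qed.

End fibres.

Section product_fibres.
Context (dd : measure_display) (X : measurableType dd) (I : finType) (t : X -> I).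

Lemma preimage_pair_fibre (q : I * I) :
  (fun z : X * X => (t z.1, t z.2)) @^-1` [set q] =
  (t @^-1` [set q.1]) `*` (t @^-1` [set q.2]).
Proof. by apply/seteqP; split=> -[x y] /=; case: q => i j /= [-> ->]. Qed.

Lemma measurable_pair_fibre : (forall i, measurable (t @^-1` [set i])) ->
  forall q, measurable ((fun z : X * X => (t z.1, t z.2)) @^-1` [set q]).
Proof. by move=> mt q; rewrite preimage_pair_fibre; exact: measurableX. Qed.

End product_fibres.

Lemma transport_planC (R : realType) (I J : finType) (a : I -> R) (b : J -> R)
    (p : I -> J -> R) :
  transport_plan a b p -> transport_plan b a (fun j i => p i j).
Proof. by case. Qed.

Section transport_plan.
Context (R : realType) (I J : finType) (a : I -> R) (b : J -> R) (p : I -> J -> R).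
Hypothesis plan_p : transport_plan a b p.

Let p_ge0 i j : 0 <= p i j. Proof. by case: plan_p. Qed.

Let row_sum i : \sum_j p i j = a i. Proof. by case: plan_p. Qed.

Let col_sum j : \sum_i p i j = b j. Proof. by case: plan_p. Qed.

Lemma transport_plan_ratioK i j : p i j / (a i * b j) * (a i * b j) = p i j.
Proof.
have p_le_row : p i j <= a i by rewrite -row_sum; exact: ler_sumr_term.
have p_le_col : p i j <= b j.
  by rewrite -col_sum; exact: (ler_sumr_term i (p_ge0^~ j)).
have [ab0|ab0] := eqVneq (a i * b j) 0; last by rewrite divfK.
apply/esym/eqP; rewrite ab0 mulr0 eq_le p_ge0 andbT.
by move/eqP: ab0; rewrite mulf_eq0 => /orP[/eqP <-|/eqP <-].
Qed.

Lemma transport_plan_reweight (a' : I -> R) : (forall i, 0 <= a' i <= a i) ->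
  \sum_i \sum_j p i j / (a i * b j) * (a' i * b j) = \sum_i a' i.
Proof.
move=> a'_le; apply: eq_bigr => i _; have [ai0|ai0] := eqVneq (a i) 0.
  have a'0 : a' i = 0 by have := a'_le i; rewrite ai0; lra.
  by rewrite a'0; apply: big1 => j _; rewrite mul0r mulr0.
rewrite (eq_bigr (fun j => p i j * (a' i / a i))) => [|j _].
  by rewrite -mulr_suml row_sum mulrC divfK.
by rewrite -[in RHS](transport_plan_ratioK i j) -[RHS]mulrA; congr (_ * _); field.
Qed.

End transport_plan.

Section coupling_of_plan.
Context (R : realType) (dd : measure_display) (X : measurableType dd).
Variables (nu mu : probability X R) (I : finType) (t : X -> I).

Let A i := t @^-1` [set i].

Hypothesis mA : forall i, measurable (A i).

Let a := fibre_mass nu t.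
Let b := fibre_mass mu t.

Variable p : I -> I -> R.
Hypothesis plan_p : transport_plan a b p.

Let w (q : I * I) := p q.1 q.2 / (a q.1 * b q.2).

Let density (z : X * X) := w (t z.1, t z.2).

Let w_ge0 q : 0 <= w q.
Proof. by case: plan_p => p0 _ _; rewrite divr_ge0// mulr_ge0// fibre_mass_ge0. Qed.

Let integral_rectangle E F : measurable E -> measurable F ->
  (\int[nu \x mu]_(z in E `*` F) (density z)%:E =
   (\sum_i \sum_j p i j / (a i * b j) *
      (fine (nu (A i `&` E)) * fine (mu (A j `&` F))))%:E)%E.
Proof.
move=> mE mF; have mEF := measurableX mE mF.
rewrite (integral_fibre (measurable_pair_fibre mA) w mEF); last first.
  by rewrite /= product_measure1E// ltey_eq fin_numM// fin_num_measure.
rewrite pair_bigA/= -sumEFin; apply: eq_bigr => -[i j] _ /=.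
rewrite preimage_pair_fibre/= -/(A i) -/(A j) -setXI.
rewrite product_measure1E//; [|exact: measurableI..].
rewrite [RHS]EFinM; congr (_ * _)%E.
by rewrite EFinM !fineK// fin_num_measure//; exact: measurableI.
Qed.

Let fibre_le (P : probability X R) E i : measurable E ->
  0 <= fine (P (A i `&` E)) <= fibre_mass P t i.
Proof.
move=> mE; rewrite fine_ge0//= -[fibre_mass P t i]/(fine (P (A i))).
rewrite fine_le ?fin_num_measure//; first exact: measurableI.
by apply: le_measure; rewrite ?inE//; exact: measurableI.
Qed.

Let marginal_fst E : measurable E ->
  (\int[nu \x mu]_(z in E `*` setT) (density z)%:E = nu E)%E.
Proof.
move=> mE; rewrite integral_rectangle//.
under eq_bigr do under eq_bigr do rewrite setIT.
rewrite (transport_plan_reweight plan_p) => [|i]; last exact: fibre_le.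
by rewrite (sum_fibre_measure mA)// fineK// fin_num_measure.
Qed.

Let marginal_snd E : measurable E ->
  (\int[nu \x mu]_(z in setT `*` E) (density z)%:E = mu E)%E.
Proof.
move=> mE; rewrite integral_rectangle// exchange_big/=.
under eq_bigr do under eq_bigr do rewrite setIT (mulrC (a _)) (mulrC (fine (nu _))).
rewrite (transport_plan_reweight (transport_planC plan_p)) => [|i].
  by rewrite (sum_fibre_measure mA)// fineK// fin_num_measure.
exact: fibre_le.
Qed.

(* Inside each cell [A i `*` A j], spread the mass [p i j] as the product of the
   conditional probabilities. *)
Lemma exists_coupling_of_plan : exists2 pi : probability (X * X)%type R,
  coupling nu mu pi & forall c : I -> I -> R,
    \int[pi]_z c (t z.1) (t z.2) = transport_cost c p.
Proof.
have [mdensity _] := bounded_measurable_fibre (measurable_pair_fibre mA) w.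
have density1 : (\int[nu \x mu]_z (density z)%:E = 1)%E.
  by rewrite -setXTT marginal_fst// probability_setT.
have [pi [_ _ piE]] :=
  exists_probability_density mdensity (fun z => w_ge0 _) density1.
exists pi => [E F mE mF|c].
  by rewrite !piE ?marginal_fst ?marginal_snd//; exact: measurableX.
rewrite (Rintegral_fibre (measurable_pair_fibre mA) pi (fun q => c q.1 q.2)).
rewrite /transport_cost pair_bigA; apply: eq_bigr => -[i j] _ /=; congr (_ * _).
rewrite /fibre_mass piE; last exact: measurable_pair_fibre.
rewrite (eq_integral (cst (w (i, j))%:E)) => [|z]; last first.
  by rewrite inE /density => -> /=.
rewrite integral_cst; last exact: measurable_pair_fibre.
rewrite preimage_pair_fibre /= -/(A i) -/(A j) product_measure1E//.
rewrite !fineM ?fin_numM ?fin_num_measure//=.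
exact: (transport_plan_ratioK plan_p).
Qed.

End coupling_of_plan.

Section image_measure.
Context (R : realType) (dT dY : measure_display).
Context (T : measurableType dT) (Y : measurableType dY).
Variables (phi : T -> Y) (P : probability T R) (Q : probability Y R).
Hypothesis mphi : measurable_fun [set: T] phi.
Hypothesis QE : forall A, measurable A -> P (phi @^-1` A) = Q A.

Lemma integrable_image (f : Y -> R) : Q.-integrable setT (EFin \o f) ->
  P.-integrable setT (EFin \o (f \o phi)).
Proof.
move=> /integrableP[mf f_fin]; apply/integrableP; split.
  exact: measurableT_comp mf mphi.
apply: le_lt_trans f_fin.
have := @ge0_integral_pushforward _ _ _ _ _ phi mphi P setT
  (fun y => `|(f y)%:E|)%E measurableT.
rewrite preimage_setT => <-//; last exact: measurableT_comp.
by rewrite (eq_measure_integral Q)// => A mA _; exact: QE.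
Qed.

Lemma Rintegral_image (f : Y -> R) : Q.-integrable setT (EFin \o f) ->
  \int[P]_x f (phi x) = \int[Q]_y f y.
Proof.
move=> f_int; have := @integral_pushforward _ _ _ _ _ phi mphi P setT _
  (measurable_int _ f_int); rewrite preimage_setT.
move=> /(_ (integrable_image f_int) measurableT) /(congr1 fine).
by rewrite (eq_measure_integral Q) => [/esym|A mA _]; [exact|exact: QE].
Qed.

End image_measure.

(** * Near-optimal couplings *)

Section cells.
Context (R : realType) (dd : measure_display) (X : measurableType dd).
Variables (d : X -> X -> R) (nu mu : probability X R).
Hypothesis d_polish : polish_borel d.

Let d_ge0 x y : 0 <= d x y. Proof. by case: (polish_is_metric d_polish). Qed.
Let dC x y : d x y = d y x. Proof. by case: (polish_is_metric d_polish). Qed.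
Let d_triangle x y z : d x z <= d x y + d y z.
Proof. by case: (polish_is_metric d_polish). Qed.

Variables (I : finType) (t : X -> I) (pt : I -> X).
Hypothesis mt : forall i, measurable (t @^-1` [set i]).

Let err := quantisation_error d t pt.

Let cell_cost i j := d (pt i) (pt j) ^+ 2.

Lemma cell_cost_le eta x y : 0 < eta -> cell_cost (t x) (t y) <=
  (1 + eta) * (d x y ^+ 2 + 2 / eta * (err x + err y)).
Proof.
move=> eta0; apply: sqrD3_le => //.
have := d_triangle (pt (t x)) x (pt (t y)); have := d_triangle x y (pt (t y)).
by rewrite (dC (pt (t x)) x); lra.
Qed.

Lemma sqr_dist_le_cell_cost eta x y : 0 < eta -> d x y ^+ 2 <=
  (1 + eta) * (cell_cost (t x) (t y) + 2 / eta * (err x + err y)).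
Proof.
move=> eta0; apply: sqrD3_le => //.
have := d_triangle x (pt (t x)) y; have := d_triangle (pt (t x)) (pt (t y)) y.
by rewrite (dC (pt (t y))); lra.
Qed.

Hypotheses (nu_err : nu.-integrable setT (EFin \o err))
  (mu_err : mu.-integrable setT (EFin \o err)).

Let total_err := \int[nu]_x err x + \int[mu]_x err x.

Lemma W2sq_le_cell_cost (pi : probability (X * X)%type R) eta : 0 < eta ->
  coupling nu mu pi -> (W2sq d nu mu <=
    ((1 + eta) * (\int[pi]_z cell_cost (t z.1) (t z.2) + 2 / eta * total_err))%:E)%E.
Proof.
move=> eta0 pi_coupling.
have fstE A : measurable A -> pi (fst @^-1` A) = nu A.
  move=> mA; have [<- _] := pi_coupling A setT mA measurableT.
  by congr (pi _); apply/seteqP; split=> z //= [].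
have sndE A : measurable A -> pi (snd @^-1` A) = mu A.
  move=> mA; have [_ <-] := pi_coupling setT A measurableT mA.
  by congr (pi _); apply/seteqP; split=> z //= [].
have int_fst := integrable_image measurable_fst fstE nu_err.
have int_snd := integrable_image measurable_snd sndE mu_err.
have int_cost : pi.-integrable setT (EFin \o (fun z => cell_cost (t z.1) (t z.2))).
  apply: bounded_measurable_integrable.
  exact: (bounded_measurable_fibre (measurable_pair_fibre mt)
    (fun q => cell_cost q.1 q.2)).
have int_err : pi.-integrable setT (EFin \o (fun z => err z.1 + err z.2)).
  by apply: eq_integrable (integrableD _ int_fst int_snd).
have int_Zerr : pi.-integrable setT (EFin \o
    (fun z => 2 / eta * (err z.1 + err z.2))).
  by apply: eq_integrable (integrableZl _ (2 / eta) int_err).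
have int_bound : pi.-integrable setT (EFin \o
    (fun z => cell_cost (t z.1) (t z.2) + 2 / eta * (err z.1 + err z.2))).
  by apply: eq_integrable (integrableD _ int_cost int_Zerr).
have -> : total_err = \int[pi]_z (err z.1 + err z.2).
  rewrite RintegralD// (Rintegral_image measurable_fst fstE nu_err).
  by rewrite (Rintegral_image measurable_snd sndE mu_err).
rewrite -RintegralZl// -RintegralD// -RintegralZl//.
rewrite /Rintegral fineK; last first.
  exact: integrable_fin_num (integrableZl measurableT (1 + eta) int_bound).
apply: (@le_trans _ _ (\int[pi]_z (d z.1 z.2 ^+ 2)%:E)%E).
  by apply: ereal_inf_lbound; exists pi.
by apply: le_integralT => z; rewrite lee_fin sqr_dist_le_cell_cost.
Qed.

Variables (lam H eta : R) (g : X -> R).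
Hypotheses (lam_gt0 : 0 < lam) (mu_bg : bobkov_goetze d mu lam).
Hypotheses (gd : is_density mu nu g) (gH : entropy mu g = H%:E).
Hypothesis eta_gt0 : 0 < eta.

Let eta1 : 0 < 1 + eta. Proof. by rewrite addr_gt0. Qed.

Let K := 2 * lam / eta.

Lemma cell_dual_value_le (u v : I -> R) :
  (forall i j, u i + v j <= lam / (1 + eta) * cell_cost i j) ->
  \sum_i fibre_mass nu t i * u i + \sum_j fibre_mass mu t j * v j <=
  H + K * total_err.
Proof.
move=> uv; have K0 : 0 <= K by rewrite divr_ge0 ?mulr_ge0 ?ltW.
have Kerr0 x : 0 <= K * err x by rewrite mulr_ge0 ?sqr_ge0.
have int_u := bounded_measurable_integrable nu (bounded_measurable_fibre mt u).
have int_Nv := bounded_measurable_integrable mu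
  (bounded_measurable_fibre mt (fun j => - v j)).
have int_Kerr (P : probability X R) : P.-integrable setT (EFin \o err) ->
    P.-integrable setT (EFin \o (fun x => K * err x)).
  by move=> P_err; apply: eq_integrable (integrableZl _ K P_err).
pose phi x := u (t x) - K * err x; pose psi y := - v (t y) + K * err y.
have int_phi : nu.-integrable setT (EFin \o phi).
  by apply: eq_integrable (integrableB _ int_u (int_Kerr _ nu_err)).
have int_psi : mu.-integrable setT (EFin \o psi).
  by apply: eq_integrable (integrableD _ int_Nv (int_Kerr _ mu_err)).
have Rintegral_phi_psi : \int[nu]_x phi x - \int[mu]_x psi x =
    \sum_i fibre_mass nu t i * u i + \sum_j fibre_mass mu t j * v j - K * total_err.
  rewrite RintegralB ?RintegralD ?RintegralZl ?int_Kerr// !(Rintegral_fibre mt).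
  rewrite (Rintegral_fibre mt _ (fun j => - v j)) /total_err.
  under [X in _ - (X + _) = _]eq_bigr do rewrite mulrN.
  by rewrite sumrN; ring.
pose N := \sum_i `|u i| + \sum_j `|v j|.
have uN i : u i <= N.
  rewrite (le_trans (ler_norm _))// ler_wpDr ?sumr_ge0//.
  exact: (ler_sumr_term (F := fun i => `|u i|)).
have vN j : v j <= N.
  rewrite (le_trans (ler_norm _))// ler_wpDl ?sumr_ge0//.
  exact: (ler_sumr_term (F := fun j => `|v j|)).
rewrite -lerBlDr -Rintegral_phi_psi -lee_fin -gH.
apply: (dual_value_le_entropy d_polish lam_gt0 mu_bg (N := N) gd int_phi int_psi).
- by move=> x; have := Kerr0 x; have := uN (t x); rewrite /phi; lra.
- by move=> y; have := Kerr0 y; have := vN (t y); rewrite /psi; lra.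
- move=> x y.
  have := ler_wpM2l (ltW (divr_gt0 lam_gt0 eta1)) (cell_cost_le x y eta_gt0).
  have -> : lam / (1 + eta) * ((1 + eta) * (d x y ^+ 2 + 2 / eta * (err x + err y))) =
      lam * d x y ^+ 2 + K * err x + K * err y by rewrite /K; field; rewrite !gt_eqF.
  by have := uv (t x) (t y); rewrite /phi /psi; lra.
Qed.

Lemma W2sq_le_entropy_cells : K * total_err <= eta ->
  (W2sq d nu mu <= ((1 + eta) ^+ 2 / lam * (H + 3 * eta))%:E)%E.
Proof.
move=> K_err; have c_ge0 i j : 0 <= lam / (1 + eta) * cell_cost i j.
  by rewrite mulr_ge0 ?sqr_ge0// divr_ge0// ltW.
have [p [u [v [plan_p uv]]]] := finite_transport_duality c_ge0
  (fibre_mass_ge0 t nu) (fibre_mass_ge0 t mu) (sum_fibre_mass mt nu)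
  (sum_fibre_mass mt mu) eta_gt0.
rewrite transport_costZ => cost_le; have dual_le := cell_dual_value_le uv.
have [pi pi_coupling piE] := exists_coupling_of_plan mt plan_p.
apply: (le_trans (W2sq_le_cell_cost eta_gt0 pi_coupling)); rewrite lee_fin piE.
set cost := transport_cost cell_cost p in cost_le *.
have {cost_le}cost_le : lam * cost <= (1 + eta) * (H + 2 * eta).
  by rewrite (mulrC (1 + eta)) -ler_pdivrMr// mulrAC; lra.
have -> : (1 + eta) * (cost + 2 / eta * total_err) =
    (1 + eta) / lam * (lam * cost + K * total_err).
  by rewrite /K; field; rewrite !gt_eqF.
have -> : (1 + eta) ^+ 2 / lam * (H + 3 * eta) =
    (1 + eta) / lam * ((1 + eta) * (H + 3 * eta)) by field; rewrite gt_eqF.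
rewrite ler_wpM2l ?divr_ge0 ?ltW//.
by have := mulr_gt0 eta_gt0 eta_gt0; lra.
Qed.

End cells.

Section bobkov_goetze_T2.
Context (R : realType) (dd : measure_display) (X : measurableType dd).
Variables (d : X -> X -> R) (mu : probability X R).
Hypothesis d_polish : polish_borel d.

Lemma W2sq_le_entropy_approx (nu : probability X R) (g : X -> R) (lam H eta : R) :
  0 < lam -> bobkov_goetze d mu lam -> is_density mu nu g ->
  entropy mu g = H%:E -> 0 < eta ->
  (W2sq d nu mu <= ((1 + eta) ^+ 2 / lam * (H + 3 * eta))%:E)%E.
Proof.
move=> lam0 mu_bg gd gH eta0.
have mu_moment := integrable_sqr_dist d_polish lam0 mu_bg.
have nu_moment x0 :=
  integrable_sqr_dist_density d_polish lam0 mu_bg gd gH (mu_moment x0).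
pose K := 2 * lam / eta; have K0 : 0 < K by rewrite divr_gt0// mulr_gt0.
have e0 : 0 < K^-1 * eta / 2 by rewrite divr_gt0// mulr_gt0 ?invr_gt0.
have [n [t [pt [mt [nu_err nu_small] [mu_err mu_small]]]]] :=
  exists_quantisation d_polish e0 nu_moment mu_moment.
apply: (W2sq_le_entropy_cells d_polish mt nu_err mu_err lam0 mu_bg gd gH eta0).
by rewrite -/K -ler_pdivlMl// [leRHS]splitr lerD.
Qed.

Lemma T2_of_bobkov_goetze (lam : R) :
  0 < lam -> bobkov_goetze d mu lam -> T2 d mu lam^-1.
Proof.
move=> lam0 mu_bg nu; have lamV : 0 < lam^-1 by rewrite invr_gt0.
rewrite -lee_pdivrMl//; apply: le_ereal_inf_tmp => _ [g gd <-].
rewrite lee_pdivrMl// -/(entropy mu g).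
have := entropy_ge0 gd; case gH : (entropy mu g) => [H| |] // H0; last first.
  by rewrite gt0_muley ?lte_fin// leey.
pose f eta := (1 + eta) ^+ 2 / lam * (H + 3 * eta).
have -> : (lam^-1%:E * H%:E)%E = (f 0)%:E by rewrite -EFinM /f; congr (_%:E); ring.
apply: lee_at_right => [|eta eta0]; last first.
  exact: (W2sq_le_entropy_approx lam0 mu_bg gd gH).
by apply/differentiable_continuous/derivable1_diffP; exact: ex_derive.
Qed.

Lemma relent_ge0 (nu : probability X R) : (0 <= relent mu nu)%E.
Proof. by apply: le_ereal_inf_tmp => _ [g gd <-]; exact: entropy_ge0 gd. Qed.

Lemma T2_right_closed (C : R) : 0 < C ->
  (forall C', C < C' -> T2 d mu C') -> T2 d mu C.
Proof.
move=> C0 muT2 nu; have := relent_ge0 nu; case nuH : (relent mu nu) => [H| |] // H0.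
  rewrite -EFinM; apply: (@lee_at_right _ (fun t => t * H)) => [|C' CC'].
    by apply: cvgM; [exact: cvg_id|exact: cvg_cst].
  by rewrite EFinM -nuH; exact: muT2.
by rewrite gt0_muley ?lte_fin// leey.
Qed.

End bobkov_goetze_T2.

Theorem theorem3p3 (R : realType) (dd : measure_display) (X : measurableType dd)
  (d : X -> X -> R) (mu : probability X R) (lam0 D : R) :
  polish_borel d -> 0 < lam0 -> 0 < D ->
  (forall (nu : probability X R) (f : X -> R), inF d lam0 f ->
     (forall A, measurable A -> (nu A = \int[mu]_(x in A) (expR (f x))%:E)%E) ->
     (relent mu nu <= D%:E * fisher d mu f)%E) ->
  T2 d mu (Num.max (4 * D) lam0^-1).
Proof.
move=> d_polish lam0_gt0 D_gt0 lsi.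
apply: T2_right_closed => [|C]; first by rewrite lt_max invr_gt0 lam0_gt0 orbT.
rewrite gt_max => /andP[D_C lam0_C].
have C_gt0 : 0 < C by rewrite (lt_trans _ D_C)// mulr_gt0.
rewrite -[C]invrK; apply: T2_of_bobkov_goetze; rewrite ?invr_gt0//.
apply: (bobkov_goetze_of_log_sobolev d_polish D_gt0 _ _ _ lsi).
- by rewrite invr_gt0.
- by rewrite invf_plt.
- by rewrite ler_pdivrMr// mul1r ltW.
Qed.
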